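(* Let $f:\mathbb{R}^n\to\overline{\mathbb{R}}=\mathbb{R}\cup\{\pm\infty\}$ be a function, $\bar{x}\in\mathbb{R}^n$ a point where $f$ is finite and locally lower semicontinuous, and $X\subset\operatorname{dom}f$ a closed and convex set with $\bar{x}\in X$. Then the following conditions are equivalent: (a) $f$ is locally Lipschitz continuous at $\bar{x}$ relative to $X$. (b) The mapping $x\mapsto\operatorname{proj}_{T_X(x)}\partial(f+\delta_X)(x)$ is locally bounded at $\bar{x}$. (c) The mapping $x\mapsto\partial_Xf(x)$ is locally bounded at $\bar{x}$. (d) $\partial_X^\infty f(\bar{x})=\{0\}$. Moreover, when these conditions hold, the following properties hold: (i) The inclusion $\partial^\infty(f+\delta_X)(x)\subset N_X(x)$ holds for all $x$ close enough to $\bar{x}$ in $X$. (ii) The projectional coderivative of the profile mapping $E_f$ at $\bar{x}$ for $f(\bar{x})$ with respect to $X$ is given by $$D^*_XE_f(\bar{x}\mid f(\bar{x}))(\lambda)=\begin{cases}\lambda\,\partial_Xf(\bar{x})&\text{if }\lambda>0,\\ \partial_X^\infty f(\bar{x})&\text{if }\lambda=0,\\ \emptyset&\text{if }\lambda<0.\end{cases}$$ (iii) $\partial_Xf(\bar{x})$ is nonempty and compact, with $$\operatorname{lip}_Xf(\bar{x})=\max_{v\in\partial_Xf(\bar{x})}\|v\|.$$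
   Context: $\operatorname{dom}f=\{x\mid f(x)<+\infty\}$. $f$ is locally lower semicontinuous at $\bar{x}$ (where it is finite) if there is $\epsilon>0$ such that all sets $\{x\mid\|x-\bar{x}\|\le\epsilon,\ f(x)\le\alpha\}$ with $\alpha\le f(\bar{x})+\epsilon$ are closed (equivalently, the epigraph of $f$ is locally closed at $(\bar x,f(\bar x))$). $\delta_X$ is the indicator function ($0$ on $X$, $+\infty$ off $X$). Relative Lipschitz continuity: $\operatorname{lip}_Xf(\bar{x})=\limsup_{x,x'\to\bar{x};\ x,x'\in X,\ x\ne x'}\frac{|f(x)-f(x')|}{\|x-x'\|}$ (equal to $0$ if $\bar{x}$ is isolated in $X$), and $f$ is locally Lipschitz continuous at $\bar{x}$ relative to $X$ if $\operatorname{lip}_Xf(\bar{x})<+\infty$. Normal cones: for $x\in A$, the tangent (contingent) cone $T_A(x)$ consists of all $w$ for which there exist $t_k\downarrow0$, $w_k\to w$ with $x+t_kw_k\in A$; $\widehat{N}_A(x)=\{v\mid\langle v,w\rangle\le0\ \forall w\in T_A(x)\}$; $N_A(x)$ is the set of all limits of $v_k\in\widehat{N}_A(x_k)$ with $x_k\in A$, $x_k\to x$. Subgradients: at a point $x$ with $g(x)$ finite, $v\in\widehat{\partial}g(x)$ if $g(y)\ge g(x)+\langle v,y-x\rangle+o(\|y-x\|)$; $v\in\partial g(x)$ if there are $x_k\to x$ with $g(x_k)\to g(x)$ and $v_k\in\widehat{\partial}g(x_k)$ with $v_k\to v$; $v\in\partial^\infty g(x)$ if there are $x_k\to x$ with $g(x_k)\to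 g(x)$, $\lambda_k\downarrow0$ and $v_k\in\widehat{\partial}g(x_k)$ with $\lambda_kv_k\to v$. If $g(x)$ is not finite these sets are empty. Projections: $\operatorname{proj}_A(x)$ is the set of points of $A$ nearest to $x$; $\operatorname{proj}_AM=\bigcup_{x\in M}\operatorname{proj}_A(x)$; $\operatorname{proj}_A\emptyset=\emptyset$. In (b), the set $\operatorname{proj}_{T_X(x)}\partial(f+\delta_X)(x)$ is taken to be $\emptyset$ for $x\notin X$. Projectional subgradients (for convex $X$, $x\in X$, $f(x)$ finite): $v\in\partial_Xf(x)$ if there are $x_k\to x$ with $x_k\in X$, $f(x_k)\to f(x)$, and $v_k\in\partial(f+\delta_X)(x_k)$ with $\operatorname{proj}_{T_X(x_k)}(v_k)\to v$; $v\in\partial_X^\infty f(x)$ (horizon projectional subgradient) if there are $\lambda_k\downarrow0$, $x_k\to x$ with $x_k\in X$, $f(x_k)\to f(x)$, and $v_k\in\partial(f+\delta_X)(x_k)$ with $\lambda_k\operatorname{proj}_{T_X(x_k)}(v_k)\to v$. For $x\notin X$ both sets are empty. A set-valued mapping is locally bounded at $\bar{x}$ if the union of its values over some neighborhood of $\bar{x}$ is bounded. Profile mapping: $E_f:\mathbb{R}^n\rightrightarrows\mathbb{R}$, $E_f(x)=\{\alpha\in\mathbb{R}\mid\alpha\ge f(x)\}$. Projectional coderivative: for $S:\mathbb{R}^n\rightrightarrows\mathbb{R}^m$ let $\operatorname{gph}S=\{(x,u)\mid u\in S(x)\}$, and let $S|_X$ be $S$ on $X$ and $\emptyset$ off $X$;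 $x^*\in D^*S|_X(x\mid u)(u^* )\iff(x^*,-u^* )\in N_{\operatorname{gph}S|_X}(x,u)$. For $\bar x\in X$, $\bar u\in S(\bar x)$, $x^*\in D_X^*S(\bar{x}\mid\bar{u})(u^* )$ if and only if there are $(x_k,u_k)\to(\bar{x},\bar{u})$ in $\operatorname{gph}S|_X$ and $x_k^*\in D^*S|_X(x_k\mid u_k)(u_k^* )$ with $u_k^*\to u^*$ and $\operatorname{proj}_{T_X(x_k)}(x_k^* )\to x^*$. *)

(* Defs.v *)
(* The ambient space is 'rV[R]_n with R : realType.  The library equips it
   with the sup norm `|x|; that norm is used below only through the notions it
   shares with the Euclidean norm (limits, neighborhoods, closed, compact and
   bounded sets).  Every metric quantity uses the Euclidean norm [enorm]. *)
From HB Require Import structures.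
From mathcomp Require Import all_boot all_order all_algebra.
From mathcomp Require Import all_classical all_reals all_analysis.

Set Implicit Arguments.
Unset Strict Implicit.
Unset Printing Implicit Defensive.

Import Order.TTheory GRing.Theory Num.Theory.
Import numFieldNormedType.Exports.

Local Open Scope classical_set_scope.
Local Open Scope ring_scope.

Section Euclidean.
Context {R : realType} {n : nat}.
Implicit Types (x y u v w : 'rV[R]_n) (A M X : set 'rV[R]_n).

Definition dotp u v : R := (u *m v^T) 0 0.

Definition enorm u : R := Num.sqrt (dotp u u).

Definition proj A x : set 'rV[R]_n :=
  [set a | A a /\ forall b, A b -> enorm (x - a) <= enorm (x - b)].

Definition proj_set A M : set 'rV[R]_n := \bigcup_(x in M) proj A x.

Definition tangent_cone A x : set 'rV[R]_n :=
  [set w | A x /\ exists (t_ : nat -> R) (w_ : nat -> 'rV[R]_n),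
    [/\ forall k, 0 < t_ k,
        t_ @ \oo --> 0,
        w_ @ \oo --> w &
        forall k, A (x + t_ k *: w_ k)]].

Definition regular_normal_cone A x : set 'rV[R]_n :=
  [set v | A x /\ forall w, tangent_cone A x w -> dotp v w <= 0].

Definition normal_cone A x : set 'rV[R]_n :=
  [set v | A x /\ exists (x_ v_ : nat -> 'rV[R]_n),
    [/\ forall k, A (x_ k) /\ regular_normal_cone A (x_ k) (v_ k),
        x_ @ \oo --> x &
        v_ @ \oo --> v]].

Definition locally_bounded (F : 'rV[R]_n -> set 'rV[R]_n) x : Prop :=
  exists2 U, nbhs x U & bounded_set (\bigcup_(y in U) F y).

End Euclidean.

Section Functions.
Context {R : realType} {n : nat}.
Implicit Types (f g : 'rV[R]_n -> \bar R) (X : set 'rV[R]_n) (x v : 'rV[R]_n).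

Definition dom f : set 'rV[R]_n := [set x | (f x < +oo)%E].

Definition delta X x : \bar R := if x \in X then 0%:E else +oo%E.

(* The addition is [dual_adde], for which (-oo) + (+oo) = +oo: f + delta_X must
   be +oo off X even where f takes the value -oo. *)
Definition plus_delta f X x : \bar R := dual_adde (f x) (delta X x).

Definition locally_lsc f x : Prop :=
  exists2 e : R, 0 < e &
    forall a : R, (a%:E <= f x + e%:E)%E ->
      closed [set y | enorm (y - x) <= e /\ (f y <= a%:E)%E].

Definition lip X f x : \bar R :=
  if `[< isolated X x >] then 0%E else
  limf_esup
    (fun p : 'rV[R]_n * 'rV[R]_n =>
       (`|f p.1 - f p.2| * (enorm (p.1 - p.2))^-1%:E)%E)
    (within [set p | [/\ X p.1, X p.2 & p.1 <> p.2]] (nbhs (x, x))).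

Definition locally_lipschitz X f x : Prop := (lip X f x < +oo)%E.

Definition regular_subdiff g x : set 'rV[R]_n :=
  [set v | g x \is a fin_num /\
    forall e : R, 0 < e -> \forall y \near x,
      (g x + (dotp v (y - x) - e * enorm (y - x))%:E <= g y)%E].

Definition subdiff g x : set 'rV[R]_n :=
  [set v | g x \is a fin_num /\ exists (x_ v_ : nat -> 'rV[R]_n),
    [/\ x_ @ \oo --> x,
        g \o x_ @ \oo --> g x,
        forall k, regular_subdiff g (x_ k) (v_ k) &
        v_ @ \oo --> v]].

Definition horizon_subdiff g x : set 'rV[R]_n :=
  [set v | g x \is a fin_num /\
    exists (x_ v_ : nat -> 'rV[R]_n) (l_ : nat -> R),
    [/\ x_ @ \oo --> x,
        g \o x_ @ \oo --> g x,
        (forall k, 0 < l_ k) /\ l_ @ \oo --> 0,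
        forall k, regular_subdiff g (x_ k) (v_ k) &
        (fun k => l_ k *: v_ k) @ \oo --> v]].

(* In the next two definitions [w_ k] is the projection of a subgradient [v_ k]
   on the tangent cone, a single point when X is closed and convex. *)
Definition proj_subdiff X f x : set 'rV[R]_n :=
  [set v | X x /\ f x \is a fin_num /\ exists (x_ v_ w_ : nat -> 'rV[R]_n),
    [/\ (forall k, X (x_ k)) /\ x_ @ \oo --> x,
        f \o x_ @ \oo --> f x,
        forall k, subdiff (plus_delta f X) (x_ k) (v_ k),
        forall k, proj (tangent_cone X (x_ k)) (v_ k) (w_ k) &
        w_ @ \oo --> v]].

Definition horizon_proj_subdiff X f x : set 'rV[R]_n :=
  [set v | X x /\ f x \is a fin_num /\
    exists (l_ : nat -> R) (x_ v_ w_ : nat -> 'rV[R]_n),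
    [/\ (forall k, 0 < l_ k) /\ l_ @ \oo --> 0,
        (forall k, X (x_ k)) /\ x_ @ \oo --> x /\ f \o x_ @ \oo --> f x,
        forall k, subdiff (plus_delta f X) (x_ k) (v_ k),
        forall k, proj (tangent_cone X (x_ k)) (v_ k) (w_ k) &
        (fun k => l_ k *: w_ k) @ \oo --> v]].

Definition proj_of_subdiff X f x : set 'rV[R]_n :=
  [set v | X x /\
    proj_set (tangent_cone X x) (subdiff (plus_delta f X) x) v].

(* Real values are encoded as row vectors of length 1, so that the graph of the
   profile mapping lives in a Euclidean space 'rV_(n + 1). *)
Definition profile f x : set 'rV[R]_1 := [set a | (f x <= (a 0 0)%:E)%E].

End Functions.

Section Coderivatives.
Context {R : realType} {n m : nat}.
Implicit Types (S : 'rV[R]_n -> set 'rV[R]_m) (X : set 'rV[R]_n).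

Definition gph S : set 'rV[R]_(n + m) :=
  [set z | S (lsubmx z) (rsubmx z)].

Definition restrict_map S X (x : 'rV[R]_n) : set 'rV[R]_m :=
  [set u | X x /\ S x u].

Definition coderivative S (x : 'rV[R]_n) (u us : 'rV[R]_m) : set 'rV[R]_n :=
  [set xs | normal_cone (gph S) (row_mx x u) (row_mx xs (- us))].

Definition proj_coderivative X S (x : 'rV[R]_n) (u us : 'rV[R]_m) :
    set 'rV[R]_n :=
  [set xs | X x /\ S x u /\
    exists (x_ : nat -> 'rV[R]_n) (u_ : nat -> 'rV[R]_m)
           (xs_ w_ : nat -> 'rV[R]_n) (us_ : nat -> 'rV[R]_m),
    [/\ forall k, restrict_map S X (x_ k) (u_ k),
        x_ @ \oo --> x /\ u_ @ \oo --> u,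
        us_ @ \oo --> us /\
        (forall k, coderivative (restrict_map S X) (x_ k) (u_ k) (us_ k) (xs_ k)),
        forall k, proj (tangent_cone X (x_ k)) (xs_ k) (w_ k) &
        w_ @ \oo --> xs]].

End Coderivatives.

(* Main.v *)
Require Import Defs.
From HB Require Import structures.
From mathcomp Require Import all_boot all_order all_algebra.
From mathcomp Require Import all_classical all_reals all_analysis.
From mathcomp Require Import ring lra.

Set Implicit Arguments.
Unset Strict Implicit.
Unset Printing Implicit Defensive.

Import Order.TTheory GRing.Theory Num.Theory.
Import numFieldNormedType.Exports.

Local Open Scope classical_set_scope.
Local Open Scope ring_scope.

(** Throughout, [g = f + delta_X], and a subgradient is controlled through the
    inequality [<v, y - x> <= L |y - x|] for all [y] in [X] ([slope_le]).  It
    bounds the projection of [v] on [T_X(x)] by [L] ([proj_le_slope]) and survives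
    limits in [x] and [v] ([slope_le_closed]), which the projection does not.

    If [f] is [L]-Lipschitz on [X] near [xbar], every regular, hence every limiting,
    subgradient of [g] nearby satisfies this inequality.  This gives the
    boundedness in (b) and (c), the bound [|v| <= lip_X f(xbar)] for projectional
    subgradients, and, after scaling horizon subgradients down, (i).  Boundedness
    of the projected subgradients kills all their limits under vanishing
    factors, which is (d).

    The converse rests on one construction.  For [b] in [X] minimize
    [f + K |. - b| + C |. - b|^2] over [X] near [xbar], where [C] is large enough
    to keep the minimizer [y] close to [xbar].  If [y <> b], then minus the
    gradient of the penalty at [y] is a regular subgradient of [g] of norm at least
    [K], and it points from [y] to [b]: by convexity of [X] it lies in [T_X(y)], so
    it is its own projection ([penalized_min_steep]).  Hence, when no such steep
    subgradient exists near [xbar], the minimizer is [b], that is,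
    [f b <= f a + K |a - b| + C |a - b|^2] for all [a], [b] in [X] near [xbar]
    ([not_steep_bound]), and the Lipschitz modulus is at most [K].  Under (d)
    steep subgradients cannot exist for all [K], since their normalizations would
    accumulate at a unit horizon vector; this is (a).  With [K] just below
    [lip_X f(xbar)] the steep subgradients must exist, and they accumulate at a
    projectional subgradient of norm [lip_X f(xbar)], which is (iii).

    For (ii), let [(v, -l)] be normal to the epigraph of [f] over [X].  The upward
    direction is tangent to it, so [l >= 0]; the rays of slope [L] in the epigraph
    give [slope_le] with constant [L l], so the projection of [v] vanishes with [l];
    and for [l > 0] the vector [v / l] is a subgradient of [g]
    ([coderivative_slope], [coderivative_subdiff]). *)

(** * Euclidean geometry of row vectors *)

Section EuclideanSpace.
Context {R : realType} {n : nat}.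
Implicit Types (u v w x y : 'rV[R]_n) (A : set 'rV[R]_n).

Lemma dotpE u v : dotp u v = \sum_i u 0 i * v 0 i.
Proof. by rewrite /dotp mxE; apply: eq_bigr => i _; rewrite mxE. Qed.

Lemma dotpC u v : dotp u v = dotp v u.
Proof. by rewrite !dotpE; apply: eq_bigr => i _; rewrite mulrC. Qed.

Lemma dotpDl u v w : dotp (u + v) w = dotp u w + dotp v w.
Proof. by rewrite /dotp mulmxDl mxE. Qed.

Lemma dotpZl c u v : dotp (c *: u) v = c * dotp u v.
Proof. by rewrite /dotp -scalemxAl mxE. Qed.

Lemma dotpNl u v : dotp (- u) v = - dotp u v.
Proof. by rewrite -scaleN1r dotpZl mulN1r. Qed.

Lemma dotpDr u v w : dotp u (v + w) = dotp u v + dotp u w.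
Proof. by rewrite ![dotp u _]dotpC dotpDl. Qed.

Lemma dotpZr c u v : dotp u (c *: v) = c * dotp u v.
Proof. by rewrite ![dotp u _]dotpC dotpZl. Qed.

Lemma dotpNr u v : dotp u (- v) = - dotp u v.
Proof. by rewrite ![dotp u _]dotpC dotpNl. Qed.

Lemma dotp0r u : dotp u 0 = 0.
Proof. by rewrite /dotp trmx0 mulmx0 mxE. Qed.

Definition dotp_linE := (dotpDl, dotpDr, dotpZl, dotpZr, dotpNl, dotpNr).

Lemma dotpp_ge0 u : 0 <= dotp u u.
Proof. by rewrite dotpE; apply: sumr_ge0 => i _; rewrite -expr2 sqr_ge0. Qed.

Lemma enorm_ge0 u : 0 <= enorm u.
Proof. exact: sqrtr_ge0. Qed.

Lemma enorm_sqr u : enorm u ^+ 2 = dotp u u.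
Proof. by rewrite sqr_sqrtr ?dotpp_ge0. Qed.

Lemma enorm0 : enorm (0 : 'rV[R]_n) = 0.
Proof. by rewrite /enorm dotp0r sqrtr0. Qed.

Lemma enorm0_eq0 u : enorm u = 0 -> u = 0.
Proof.
move=> u0; have := enorm_sqr u; rewrite u0 expr0n dotpE => /esym/eqP.
rewrite psumr_eq0 => [/allP h|i _]; last by rewrite -expr2 sqr_ge0.
apply/rowP => i; rewrite mxE; apply/eqP.
by have := h i (mem_index_enum _); rewrite mulf_eq0 orbb.
Qed.

Lemma enorm_gt0 u : u <> 0 -> 0 < enorm u.
Proof.
move=> u0; rewrite lt_neqAle enorm_ge0 andbT eq_sym.
by apply/eqP => /enorm0_eq0.
Qed.

Lemma enormZ c u : enorm (c *: u) = `|c| * enorm u.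
Proof. by rewrite /enorm dotpZl dotpZr mulrA -expr2 sqrtrM ?sqr_ge0// sqrtr_sqr. Qed.

Lemma enormN u : enorm (- u) = enorm u.
Proof. by rewrite -scaleN1r enormZ normrN1 mul1r. Qed.

Lemma enorm_subC u v : enorm (u - v) = enorm (v - u).
Proof. by rewrite -enormN opprB. Qed.

(** Cauchy-Schwarz, from the nonnegativity of the squared norm of
    [|v| u - |u| v]. *)
Lemma dotp_le u v : dotp u v <= enorm u * enorm v.
Proof.
have [u0|/eqP u0] := eqVneq u 0.
  by rewrite u0 dotpC dotp0r mulr_ge0 ?enorm_ge0.
have [v0|/eqP v0] := eqVneq v 0.
  by rewrite v0 dotp0r mulr_ge0 ?enorm_ge0.
have a0 := enorm_gt0 u0; have b0 := enorm_gt0 v0.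
have := dotpp_ge0 (enorm v *: u - enorm u *: v).
rewrite !dotp_linE -!enorm_sqr [dotp v u]dotpC.
rewrite (_ : _ + _ = 2 * (enorm u * enorm v) * (enorm u * enorm v - dotp u v));
  last by ring.
by rewrite pmulr_rge0 ?subr_ge0 // !mulr_gt0.
Qed.

Lemma enorm_triangle u v : enorm (u + v) <= enorm u + enorm v.
Proof.
rewrite -ler_sqr ?nnegrE ?addr_ge0 ?enorm_ge0// sqrrD !enorm_sqr !dotp_linE.
by rewrite [dotp v u]dotpC; have := dotp_le u v; lra.
Qed.

Lemma enorm_sub_triangle x y u : enorm (x - y) <= enorm (x - u) + enorm (u - y).
Proof. by rewrite (le_trans _ (enorm_triangle _ _))// addrA subrK. Qed.

Lemma enorm_le_dist u v : enorm u <= enorm v + enorm (u - v).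
Proof. by have := enorm_sub_triangle u 0 v; rewrite !subr0 addrC. Qed.

Lemma sup_le_enorm u : `|u| <= enorm u.
Proof.
rewrite /Num.norm /= mx_normrE; apply/bigmax_leP; split=> [|[i j] _ /=].
  exact: enorm_ge0.
rewrite (ord1 i) -ler_sqr ?nnegrE ?enorm_ge0// enorm_sqr dotpE.
rewrite (bigD1 j)//= -expr2 real_normK ?num_real// lerDl.
by apply: sumr_ge0 => k _; rewrite -expr2 sqr_ge0.
Qed.

Lemma enorm_le_sup u : enorm u <= n.+1%:R * `|u|.
Proof.
rewrite -ler_sqr ?nnegrE ?mulr_ge0 ?enorm_ge0// enorm_sqr dotpE exprMn.
apply: (@le_trans _ _ (\sum_(i < n) `|u| ^+ 2)).
  apply: ler_sum => i _; rewrite -expr2 -[leLHS]real_normK ?num_real//.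
  rewrite ler_sqr ?nnegrE// [leRHS]/Num.norm /= mx_normrE.
  by apply/bigmax_geP; right; exists (0, i).
rewrite sumr_const card_ord -[leLHS]mulr_natl ler_wpM2r ?sqr_ge0// -natrX ler_nat.
by rewrite expnS expn1 (leq_trans (leqnSn n))// leq_pmulr.
Qed.

(** The topology of row vectors comes from the sup norm; the next four lemmas
    restate its notions with Euclidean balls. *)
Lemma nbhs_enormP x A :
  nbhs x A <-> exists2 e, 0 < e & forall y, enorm (y - x) < e -> A y.
Proof.
split=> [/nbhs_ballP[e /= e0 xA]|[e e0 xA]].
  exists e => // y xy; apply: xA; rewrite -ball_normE /=.
  by rewrite distrC (le_lt_trans (sup_le_enorm _)).
apply/nbhs_ballP; exists (e / n.+1%:R); first by rewrite /= divr_gt0.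
move=> y; rewrite -ball_normE /= distrC ltr_pdivlMr// => xy.
by apply: xA; rewrite (le_lt_trans (enorm_le_sup _))// mulrC.
Qed.

Lemma cvg_enormP (u_ : nat -> 'rV[R]_n) x :
  u_ @ \oo --> x <->
  forall e, 0 < e -> \forall k \near \oo, enorm (u_ k - x) < e.
Proof.
split=> [ux e e0|h].
  have xe : nbhs x [set y | enorm (y - x) < e] by apply/nbhs_enormP; exists e.
  exact: ux xe.
move=> A /nbhs_enormP[e e0 xA].
by apply: filterS (h _ e0) => k; exact: xA.
Qed.

Lemma closed_enorm A x : closed A ->
  (forall e, 0 < e -> exists2 y, A y & enorm (y - x) < e) -> A x.
Proof.
move=> cA h; apply: cA => B /nbhs_enormP[e e0 xB].
by have [y Ay xy] := h e e0; exists y; split=> //; exact: xB.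
Qed.

Lemma bounded_enormP A :
  bounded_set A <-> exists M, forall y, A y -> enorm y <= M.
Proof.
split=> [/pinfty_ex_gt0[M M0 h]|[M h]].
  exists (n.+1%:R * M) => y Ay; apply: le_trans (enorm_le_sup _) _.
  by rewrite ler_pM2l//; exact: h.
exists M; split; first exact: num_real.
move=> M' MM' y Ay /=; rewrite (le_trans (sup_le_enorm _))//.
by rewrite (le_trans (h _ Ay))// ltW.
Qed.

(** Bolzano-Weierstrass.  A cluster point is enough below, because every limit
    is handled through its approximations. *)
Lemma bounded_cluster (u_ : nat -> 'rV[R]_n) M :
  (forall k, enorm (u_ k) <= M) ->
  exists x, forall e N, 0 < e -> exists2 k, (N <= k)%N & enorm (u_ k - x) < e.
Proof.
move=> uM; pose A := closed_ball (0 : 'rV[R]_n) (`|M| + 1).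
have r0 : 0 < `|M| + 1 by rewrite ltr_wpDl.
have cA : compact A.
  apply: bounded_closed_compact; last exact: closed_ball_closed.
  exists (`|M| + 1); split; first exact: num_real.
  move=> M' MM' y; rewrite /A closed_ballE// /closed_ball_ /= sub0r normrN => /le_trans.
  by apply; exact: ltW.
have uA : \forall k \near \oo, A (u_ k).
  apply: nearW => k; rewrite /A closed_ballE// /closed_ball_ /= sub0r normrN.
  apply: le_trans (sup_le_enorm _) _; apply: le_trans (uM k) _.
  by apply: le_trans (ler_norm M) _; rewrite lerDl.
have [x [_ xP]] := cA (u_ @ \oo) _ uA.
exists x => e N e0.
have tailN : (u_ @ \oo) (u_ @` [set k | (N <= k)%N]).
  by exists N => // k /= Nk; exists k.
have xe : nbhs x [set y | enorm (y - x) < e] by apply/nbhs_enormP; exists e.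
by have [y [[k /= Nk <-] ky]] := xP _ _ tailN xe; exists k.
Qed.

End EuclideanSpace.

(** Every limiting construction asks for sequences with prescribed limits; by this
    choice it amounts to the existence of approximations for each tolerance,
    a form in which diagonal arguments are immediate. *)
Lemma choose_approx (R : realType) (T : Type) (P : R -> T -> Prop) :
  (forall e, 0 < e -> exists s, P e s) ->
  exists s_ : nat -> T, forall k, P k.+1%:R^-1 (s_ k).
Proof.
move=> h; have /choice[s_ hs] : forall k, exists s, P k.+1%:R^-1 s.
  by move=> k; apply: h; rewrite invr_gt0.
by exists s_.
Qed.

Lemma near_invS_lt (R : realType) (e : R) : 0 < e ->
  \forall k \near \oo, k.+1%:R^-1 < e.
Proof. by move=> e0; exact: near_infty_natSinv_lt (PosNum e0). Qed.

Lemma le_of_approx (R : realType) (a b C : R) :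
  (forall e, 0 < e -> e <= 1 -> a <= b + e * C) -> a <= b.
Proof.
move=> h; apply/ler_addgt0Pr => e e0.
pose e' := Num.min 1 (e / (`|C| + 1)).
have C0 : 0 < `|C| + 1 by rewrite ltr_wpDl.
have e'0 : 0 < e' by rewrite lt_min ltr01 divr_gt0.
apply: le_trans (h e' e'0 _) _; first by rewrite ge_min lexx.
rewrite lerD2l; apply: le_trans (_ : e' * (`|C| + 1) <= _).
  by rewrite ler_pM2l// (le_trans (ler_norm _))// lerDl.
by rewrite -ler_pdivlMr// ge_min lexx orbT.
Qed.

(** * Approximation forms of the limiting constructions *)

Section Approximations.
Context {R : realType} {n : nat}.
Implicit Types (x y z v w p : 'rV[R]_n) (A X : set 'rV[R]_n).
Implicit Types (f g : 'rV[R]_n -> \bar R).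

Lemma cvg_enorm_invS (u_ : nat -> 'rV[R]_n) x :
  (forall k, enorm (u_ k - x) < k.+1%:R^-1) -> u_ @ \oo --> x.
Proof.
move=> h; apply/cvg_enormP => e /near_invS_lt; apply: filterS => k.
exact: lt_trans (h k).
Qed.

Lemma cvg0_near_lt (t_ : nat -> R) e : t_ @ \oo --> 0 -> 0 < e ->
  \forall k \near \oo, t_ k < e.
Proof.
move=> /cvgr0Pnorm_lt t0 e0; apply: filterS (t0 e e0) => k.
exact: le_lt_trans (ler_norm _).
Qed.

Lemma cvg0_invS (t_ : nat -> R) :
  (forall k, 0 < t_ k) -> (forall k, t_ k < k.+1%:R^-1) -> t_ @ \oo --> 0.
Proof.
move=> t0 h; apply/cvgr0Pnorm_lt => e /near_invS_lt; apply: filterS => k.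
by rewrite gtr0_norm//; exact: lt_trans.
Qed.

Lemma cvg_value g (x_ : nat -> 'rV[R]_n) x e :
  g x \is a fin_num -> g \o x_ @ \oo --> g x -> 0 < e ->
  \forall k \near \oo, `|fine (g (x_ k)) - fine (g x)| < e.
Proof.
move=> gx; rewrite -{1}(fineK gx) => /fine_cvgP[_ /cvgrPdist_lt h] e0.
by apply: filterS (h e e0) => k /=; rewrite distrC.
Qed.

Lemma cvg_value_invS g (x_ : nat -> 'rV[R]_n) x :
  g x \is a fin_num -> (forall k, g (x_ k) \is a fin_num) ->
  (forall k, `|fine (g (x_ k)) - fine (g x)| < k.+1%:R^-1) ->
  g \o x_ @ \oo --> g x.
Proof.
move=> gx gk h; rewrite -(fineK gx); apply/fine_cvgP; split; first exact: nearW.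
apply/cvgrPdist_lt => e /near_invS_lt; apply: filterS => k /=.
by rewrite distrC; exact: lt_trans (h k).
Qed.

Lemma tangent_coneP A x w : tangent_cone A x w <->
  A x /\ forall e, 0 < e -> exists t z,
    [/\ 0 < t, t < e, enorm (z - w) < e & A (x + t *: z)].
Proof.
split=> [[Ax [t_ [w_ [t0 tc /cvg_enormP wc H]]]]|[Ax h]]; split=> //.
  move=> e e0; have [k [tk wk]] := filter_ex (filterI (cvg0_near_lt tc e0) (wc e e0)).
  by exists (t_ k), (w_ k).
have /choose_approx[s hs] : forall e, 0 < e -> exists s : R * 'rV[R]_n,
    [/\ 0 < s.1, s.1 < e, enorm (s.2 - w) < e & A (x + s.1 *: s.2)].
  by move=> e /h[t [z ?]]; exists (t, z).
exists (fst \o s), (snd \o s); split.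
- by move=> k; case: (hs k).
- by apply: cvg0_invS => k; case: (hs k).
- by apply: cvg_enorm_invS => k; case: (hs k).
- by move=> k; case: (hs k).
Qed.

Lemma normal_coneP A x v : normal_cone A x v <->
  A x /\ forall e, 0 < e -> exists y z,
    [/\ regular_normal_cone A y z, enorm (y - x) < e & enorm (z - v) < e].
Proof.
split=> [[Ax [x_ [v_ [H /cvg_enormP xc /cvg_enormP vc]]]]|[Ax h]]; split=> //.
  move=> e e0; have [k [xk vk]] := filter_ex (filterI (xc e e0) (vc e e0)).
  by exists (x_ k), (v_ k); split=> //; case: (H k).
have /choose_approx[s hs] : forall e, 0 < e -> exists s : 'rV[R]_n * 'rV[R]_n,
    [/\ regular_normal_cone A s.1 s.2, enorm (s.1 - x) < e & enorm (s.2 - v) < e].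
  by move=> e /h[y [z ?]]; exists (y, z).
exists (fst \o s), (snd \o s); split.
- by move=> k; case: (hs k) => -[].
- by apply: cvg_enorm_invS => k; case: (hs k).
- by apply: cvg_enorm_invS => k; case: (hs k).
Qed.

Lemma subdiffP g x v : subdiff g x v <->
  g x \is a fin_num /\ forall e, 0 < e -> exists y z,
    [/\ enorm (y - x) < e, `|fine (g y) - fine (g x)| < e,
        regular_subdiff g y z & enorm (z - v) < e].
Proof.
split=> [[gx [x_ [v_ [/cvg_enormP xc gc H /cvg_enormP vc]]]]|[gx h]]; split=> //.
  move=> e e0; have [k [[xk vk] gk]] := filter_ex
    (filterI (filterI (xc e e0) (vc e e0)) (cvg_value gx gc e0)).
  by exists (x_ k), (v_ k).
have /choose_approx[s hs] : forall e, 0 < e -> exists s : 'rV[R]_n * 'rV[R]_n,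
    [/\ enorm (s.1 - x) < e, `|fine (g s.1) - fine (g x)| < e,
        regular_subdiff g s.1 s.2 & enorm (s.2 - v) < e].
  by move=> e /h[y [z ?]]; exists (y, z).
exists (fst \o s), (snd \o s); split.
- by apply: cvg_enorm_invS => k; case: (hs k).
- by apply: cvg_value_invS => // k; case: (hs k) => // _ _ [].
- by move=> k; case: (hs k).
- by apply: cvg_enorm_invS => k; case: (hs k).
Qed.

Lemma regular_subdiff_subdiff g x v : regular_subdiff g x v -> subdiff g x v.
Proof.
move=> rv; have [gx _] := rv; apply/subdiffP; split=> // e e0; exists x, v.
by rewrite !subrr enorm0 normr0.
Qed.

Lemma horizon_subdiff_approx g x v : horizon_subdiff g x v ->
  forall e, 0 < e -> exists y z l,
    [/\ 0 < l < e, enorm (y - x) < e, regular_subdiff g y z &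
        enorm (l *: z - v) < e].
Proof.
case=> gx [x_ [v_ [l_ [/cvg_enormP xc _ [l0 lc] H /cvg_enormP vc]]]] e e0.
have [k [[xk vk] lk]] := filter_ex
  (filterI (filterI (xc e e0) (vc e e0)) (cvg0_near_lt lc e0)).
by exists (x_ k), (v_ k), (l_ k); rewrite l0.
Qed.

Lemma plus_deltaE f X x : X x -> plus_delta f X x = f x.
Proof.
move=> Xx; rewrite /plus_delta /delta mem_set//.
by case: (f x) => //= r; rewrite /dual_adde /= addr0.
Qed.

Lemma plus_delta_out f X x : ~ X x -> plus_delta f X x = +oo%E.
Proof. by move=> Xx; rewrite /plus_delta /delta memNset//; case: (f x). Qed.

Lemma plus_delta_fin f X x :
  plus_delta f X x \is a fin_num -> X x /\ f x \is a fin_num.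
Proof.
have [Xx|Xx] := pselect (X x); first by rewrite plus_deltaE.
by rewrite plus_delta_out.
Qed.

Lemma subdiff_fin f X x v :
  subdiff (plus_delta f X) x v -> X x /\ f x \is a fin_num.
Proof. by case=> /plus_delta_fin. Qed.

Lemma regular_subdiffP f X x v : regular_subdiff (plus_delta f X) x v <->
  [/\ X x, f x \is a fin_num &
    forall e, 0 < e -> exists2 d, 0 < d & forall y, X y -> enorm (y - x) < d ->
      ((fine (f x) + dotp v (y - x) - e * enorm (y - x))%:E <= f y)%E].
Proof.
split=> [[/plus_delta_fin[Xx fx] h]|[Xx fx h]].
  split=> // e /h /nbhs_enormP[d d0 hd]; exists d => // y Xy /hd /=.
  by rewrite !plus_deltaE// -{1}(fineK fx) -EFinD addrA.
split; first by rewrite plus_deltaE.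
move=> e /h[d d0 hd]; apply/nbhs_enormP; exists d => // y xy /=.
have [Xy|Xy] := pselect (X y); last by rewrite (plus_delta_out _ Xy) leey.
by rewrite !plus_deltaE// -{1}(fineK fx) -EFinD addrA; exact: hd.
Qed.

Lemma proj_subdiffP X f x w : proj_subdiff X f x w <->
  X x /\ f x \is a fin_num /\ forall e, 0 < e -> exists y v p,
    [/\ enorm (y - x) < e, `|fine (f y) - fine (f x)| < e,
        subdiff (plus_delta f X) y v, Defs.proj (tangent_cone X y) v p &
        enorm (p - w) < e].
Proof.
split=> [[Xx [fx [x_ [v_ [w_ [[_ /cvg_enormP xc] fc H Hp /cvg_enormP wc]]]]]]|].
  split=> //; split=> // e e0; have [k [[xk wk] fk]] := filter_ex
    (filterI (filterI (xc e e0) (wc e e0)) (cvg_value fx fc e0)).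
  by exists (x_ k), (v_ k), (w_ k).
move=> [Xx [fx h]]; split=> //; split=> //.
have /choose_approx[s hs] : forall e, 0 < e ->
    exists s : 'rV[R]_n * 'rV[R]_n * 'rV[R]_n,
    [/\ enorm (s.1.1 - x) < e, `|fine (f s.1.1) - fine (f x)| < e,
        subdiff (plus_delta f X) s.1.1 s.1.2,
        Defs.proj (tangent_cone X s.1.1) s.1.2 s.2 & enorm (s.2 - w) < e].
  by move=> e /h[y [v [p ?]]]; exists (y, v, p).
exists (fun k => (s k).1.1), (fun k => (s k).1.2), (fun k => (s k).2); split.
- split; first by move=> k; case: (hs k) => _ _ /subdiff_fin[].
  by apply: cvg_enorm_invS => k; case: (hs k).
- by apply: cvg_value_invS => // k; case: (hs k) => // _ _ /subdiff_fin[].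
- by move=> k; case: (hs k).
- by move=> k; case: (hs k).
- by apply: cvg_enorm_invS => k; case: (hs k).
Qed.

Lemma horizon_proj_subdiffP X f x w : horizon_proj_subdiff X f x w <->
  X x /\ f x \is a fin_num /\ forall e, 0 < e -> exists y v p l,
    [/\ enorm (y - x) < e /\ `|fine (f y) - fine (f x)| < e,
        subdiff (plus_delta f X) y v, Defs.proj (tangent_cone X y) v p,
        0 < l < e & enorm (l *: p - w) < e].
Proof.
split=> [[Xx [fx [l_ [x_ [v_ [w_ [[l0 lc] [_ [/cvg_enormP xc fc]] H Hp /cvg_enormP wc]]]]]]]|].
  split=> //; split=> // e e0; have [k [[xk wk] [fk lk]]] := filter_ex
    (filterI (filterI (xc e e0) (wc e e0))
       (filterI (cvg_value fx fc e0) (cvg0_near_lt lc e0))).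
  by exists (x_ k), (v_ k), (w_ k), (l_ k); rewrite l0.
move=> [Xx [fx h]]; split=> //; split=> //.
have /choose_approx[s hs] : forall e, 0 < e ->
    exists s : 'rV[R]_n * 'rV[R]_n * 'rV[R]_n * R,
    [/\ enorm (s.1.1.1 - x) < e /\ `|fine (f s.1.1.1) - fine (f x)| < e,
        subdiff (plus_delta f X) s.1.1.1 s.1.1.2,
        Defs.proj (tangent_cone X s.1.1.1) s.1.1.2 s.1.2,
        0 < s.2 < e & enorm (s.2 *: s.1.2 - w) < e].
  by move=> e /h[y [v [p [l ?]]]]; exists (y, v, p, l).
exists (fun k => (s k).2), (fun k => (s k).1.1.1), (fun k => (s k).1.1.2),
  (fun k => (s k).1.2); split.
- have l0 k : 0 < (s k).2 by case: (hs k) => _ _ _ /andP[].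
  by split=> //; apply: cvg0_invS => // k; case: (hs k) => _ _ _ /andP[].
- split; first by move=> k; case: (hs k) => _ /subdiff_fin[].
  split; first by apply: cvg_enorm_invS => k; case: (hs k) => -[].
  by apply: cvg_value_invS => // k; case: (hs k) => -[] // _ _ /subdiff_fin[].
- by move=> k; case: (hs k).
- by move=> k; case: (hs k).
- by apply: cvg_enorm_invS => k; case: (hs k).
Qed.

End Approximations.

(** * Tangent cones of convex sets and directional bounds *)

Section Slopes.
Context {R : realType} {n : nat}.
Implicit Types (x y z v w p : 'rV[R]_n) (A X : set 'rV[R]_n).

Lemma convex_segment X x y t :
  convex_set (X : set (convex_lmodType 'rV[R]_n)) -> X x -> X y ->
  0 <= t -> t <= 1 -> X (x + t *: (y - x)).
Proof.
move=> cX Xx Xy t0 t1.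
have /set_mem := cX y x (Itv01 t0 t1) (mem_set Xy) (mem_set Xx).
rewrite (_ : x + _ = t *: y + (1 - t) *: x) //.
by rewrite scalerBr scalerBl scale1r addrCA addrC.
Qed.

Lemma tangent_direction X x y c :
  convex_set (X : set (convex_lmodType 'rV[R]_n)) -> X x -> X y -> 0 <= c ->
  tangent_cone X x (c *: (y - x)).
Proof.
move=> cX Xx Xy c0; apply/tangent_coneP; split=> // e e0.
have m0 : 0 < Num.min (e / 2) (c + 1)^-1.
  by rewrite lt_min divr_gt0// invr_gt0 ltr_wpDl.
exists (Num.min (e / 2) (c + 1)^-1), (c *: (y - x)); split=> //.
- by rewrite gt_min ltr_pdivrMr// ltr_pMr// ltr1n.
- by rewrite subrr enorm0.
- rewrite scalerA; apply: convex_segment => //; first by rewrite mulr_ge0// ltW.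
  apply: le_trans (_ : (c + 1)^-1 * c <= 1).
    by rewrite ler_wpM2r// ge_min lexx orbT.
  by rewrite mulrC ler_pdivrMr ?ltr_wpDl// mul1r lerDl.
Qed.

Lemma tangent_coneZ A x w c : 0 < c -> tangent_cone A x w ->
  tangent_cone A x (c *: w).
Proof.
move=> c0 /tangent_coneP[Ax h]; apply/tangent_coneP; split=> // e e0.
have m0 : 0 < Num.min (c * e) (e / c) by rewrite lt_min mulr_gt0// divr_gt0.
have [t [z [t0]]] := h _ m0; rewrite !lt_min => /andP[te _] /andP[_ zw] Az.
exists (t / c), (c *: z); split.
- exact: divr_gt0.
- by rewrite ltr_pdivrMr// mulrC.
- by rewrite -scalerBr enormZ gtr0_norm// mulrC -ltr_pdivlMr.
- by rewrite scalerA divfK ?gt_eqF.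
Qed.

(** The tangent cone is a cone, so comparing [p] with its multiples [t *: p]
    near [t = 1] makes [v - p] orthogonal to [p]. *)
Lemma proj_tangent_dotp A x v p : Defs.proj (tangent_cone A x) v p ->
  dotp v p = enorm p ^+ 2.
Proof.
move=> [Tp pmin].
have h s : -1 < s -> 2 * s * (dotp v p - dotp p p) <= s ^+ 2 * dotp p p.
  move=> s1; have s0 : 0 < 1 + s by rewrite -ltrBlDl sub0r.
  have H : dotp (v - p) (v - p) <=
      dotp (v - (1 + s) *: p) (v - (1 + s) *: p).
    rewrite -!enorm_sqr ler_sqr ?nnegrE ?enorm_ge0//.
    exact: pmin (tangent_coneZ s0 Tp).
  rewrite !dotp_linE [dotp p v]dotpC in H.
  by lra.
rewrite enorm_sqr; apply/eqP; rewrite -subr_eq0; set q := dotp v p - dotp p p in h *.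
have P0 := dotpp_ge0 p; have P1 : 0 < dotp p p + 1 by rewrite ltr_wpDl.
(* With [s = r * q] and [r <= 1 / (|p|^2 + 1)] the linear term dominates the
   quadratic one unless [q = 0]; the factor [|q| + 1] keeps [s] above [-1]. *)
pose r := ((dotp p p + 1) * (`|q| + 1))^-1.
have q1 : 0 < `|q| + 1 by rewrite ltr_wpDl.
have r0 : 0 < r by rewrite invr_gt0 mulr_gt0.
have rE : r * ((dotp p p + 1) * (`|q| + 1)) = 1 by rewrite mulVf// gt_eqF ?mulr_gt0.
have rq : `|r * q| < 1.
  rewrite normrM gtr0_norm// -rE ltr_pM2l//.
  by nra.
have := h (r * q); rewrite ltr_norml in rq; move: rq => /andP[rq _].
move=> /(_ rq) H.
have H2 : 2 * (r * q ^+ 2) <= r * q ^+ 2 * (r * dotp p p).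
  by move: H; congr (_ <= _); ring.
have rP : r * dotp p p <= 1.
  rewrite -rE ler_pM2l//; have := normr_ge0 q; nra.
have Q0 : 0 <= r * q ^+ 2 by rewrite mulr_ge0 ?sqr_ge0// ltW.
have : r * q ^+ 2 <= 0 by nra.
by rewrite pmulr_rle0// => q2; rewrite -sqrf_eq0 eq_le q2 sqr_ge0.
Qed.

Lemma proj_self A v : A v -> Defs.proj A v v.
Proof. by move=> Av; split=> // b Ab; rewrite subrr enorm0 enorm_ge0. Qed.

Lemma proj_tangentZ A x v p c : 0 < c -> Defs.proj (tangent_cone A x) v p ->
  Defs.proj (tangent_cone A x) (c *: v) (c *: p).
Proof.
move=> c0 [Tp pmin]; split=> [|b Tb]; first exact: tangent_coneZ.
have ci : 0 < c^-1 by rewrite invr_gt0.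
have -> : b = c *: (c^-1 *: b) by rewrite scalerA divff ?gt_eqF// scale1r.
rewrite -!scalerBr !enormZ ler_wpM2l//; apply: pmin; exact: tangent_coneZ.
Qed.

(** For convex [X] and [L >= 0] this says that [<v, w> <= L |w|] for all [w] in
    [T_X(x)], i.e. that the projection of [v] on [T_X(x)] has norm at most [L].
    Testing against points of [X] instead of tangent vectors makes the condition
    stable under limits in [x]. *)
Definition slope_le X x v (L : R) :=
  forall y, X y -> dotp v (y - x) <= L * enorm (y - x).

(** For a fixed test point [a] in [X], both sides of [<z, a - y> <= M |a - y|] are
    continuous in [(y, z, M)]. *)
Lemma slope_le_closed X x v L : 0 <= L ->
  (forall e, 0 < e -> exists y z M,
    [/\ enorm (y - x) < e, enorm (z - v) < e, M <= L + e & slope_le X y z M]) ->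
  slope_le X x v L.
Proof.
move=> L0 h a Xa.
apply: (@le_of_approx _ _ _ (enorm (a - x) + 1 + L + enorm (a - x) + enorm v + 1)).
move=> e e0 e1; have [y [z [M [yx zv ML sl]]]] := h e e0.
have D0 := enorm_ge0 (a - x); have N0 := enorm_ge0 (a - y).
have az : enorm (a - y) <= enorm (a - x) + e.
  by rewrite (le_trans (enorm_sub_triangle _ _ x))// lerD2l enorm_subC ltW.
have -> : dotp v (a - x) =
    dotp z (a - y) + dotp (v - z) (a - x) + dotp z (y - x).
  by rewrite !dotp_linE; ring.
have A1 := sl a Xa.
have A2 : M * enorm (a - y) <= (L + e) * (enorm (a - x) + e).
  by apply: le_trans (ler_wpM2r N0 ML) _; rewrite ler_wpM2l// addr_ge0// ltW.
have A3 : dotp (v - z) (a - x) <= e * enorm (a - x).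
  by apply: le_trans (dotp_le _ _) _; rewrite ler_wpM2r// enorm_subC ltW.
have A4 : dotp z (y - x) <= (enorm v + 1) * e.
  apply: le_trans (dotp_le _ _) _; apply: ler_pM; rewrite ?enorm_ge0//; last exact: ltW.
  apply: le_trans (enorm_le_dist z v) _; rewrite lerD2l.
  by apply: le_trans e1; exact: ltW.
nra.
Qed.

Lemma slope_le_tangent X x v w L : slope_le X x v L -> tangent_cone X x w ->
  dotp v w <= L * enorm w.
Proof.
move=> sl /tangent_coneP[Xx h]; apply: (@le_of_approx _ _ _ (`|L| + enorm v)).
move=> e e0 e1; have [t [z [t0 _ zw Xz]]] := h e e0.
have := sl _ Xz; rewrite addrC addKr dotpZr enormZ gtr0_norm// mulrCA ler_pM2l//.
have A1 : dotp v (w - z) <= enorm v * e.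
  by apply: le_trans (dotp_le _ _) _; rewrite ler_wpM2l ?enorm_ge0// enorm_subC ltW.
have A2 : L * (enorm z - enorm w) <= `|L| * e.
  apply: le_trans (ler_norm _) _; rewrite normrM ler_wpM2l//.
  rewrite ler_norml; have := enorm_le_dist z w; have := enorm_le_dist w z.
  by rewrite enorm_subC; lra.
have : dotp v w = dotp v z + dotp v (w - z) by rewrite !dotp_linE; ring.
by lra.
Qed.

Lemma proj_le_slope X x v p L : 0 <= L -> slope_le X x v L ->
  Defs.proj (tangent_cone X x) v p -> enorm p <= L.
Proof.
move=> L0 sl pp; have := slope_le_tangent sl (proj1 pp).
rewrite (proj_tangent_dotp pp) expr2.
have [->|p0] := eqVneq (enorm p) 0; first by [].
by rewrite ler_pM2r// lt_neqAle eq_sym p0 enorm_ge0.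
Qed.

Lemma slope_le_normal X x v : X x -> slope_le X x v 0 -> normal_cone X x v.
Proof.
move=> Xx sl; apply/normal_coneP; split=> // e e0; exists x, v.
rewrite !subrr enorm0; split=> //; split=> // w /(slope_le_tangent sl).
by rewrite mul0r.
Qed.

End Slopes.

(** * The relative Lipschitz modulus *)

Section LipschitzModulus.
Context {R : realType} {n : nat}.
Implicit Types (x y z v w p a b : 'rV[R]_n) (X : set 'rV[R]_n).
Implicit Types (f : 'rV[R]_n -> \bar R).

(** Finiteness is part of the notion because [fine] maps infinite values to 0. *)
Definition lip_ball X f x L d := forall a b,
  X a -> X b -> enorm (a - x) < d -> enorm (b - x) < d ->
  f a \is a fin_num /\ `|fine (f a) - fine (f b)| <= L * enorm (a - b).

(** A difference quotient below [L] is finite, so the value at each point near [x]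
    is finite because [x] itself is available as the second point. *)
Lemma lip_lt_ball X f x L : f x \is a fin_num -> X x -> (lip X f x < L%:E)%E ->
  exists2 d, 0 < d & lip_ball X f x L d.
Proof.
move=> fx Xx; rewrite /lip; case: asboolP => [[_ [V /nbhs_enormP[d d0 xV] VX]] L0|_].
  have VXx a : X a -> enorm (a - x) < d -> a = x.
    by move=> Xa ax; have : (V `&` X) a by [split=> //; exact: xV]; rewrite VX.
  exists d => // a b Xa Xb ax bx; rewrite (VXx a)// (VXx b)//; split=> //.
  by rewrite !subrr normr0 enorm0 mulr0.
rewrite limf_esupE => /ereal_inf_lt[_ [V xV <-] VL].
have [[A B] /= [/nbhs_enormP[d1 d10 xA] /nbhs_enormP[d2 d20 xB]] ABV] := xV.
exists (Num.min d1 d2); first by rewrite lt_min d10.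
have quot a b : X a -> X b -> enorm (a - x) < Num.min d1 d2 ->
    enorm (b - x) < Num.min d1 d2 -> a <> b ->
    (`|f a - f b| * (enorm (a - b))^-1%:E < L%:E)%E.
  rewrite !lt_min => Xa Xb /andP[ax _] /andP[_ bx] ab.
  apply: le_lt_trans VL; apply: ereal_sup_ubound; exists (a, b) => //.
  by apply: (ABV (a, b)) => /=; [split; [exact: xA|exact: xB]|].
have x0 : enorm (x - x) < Num.min d1 d2 by rewrite subrr enorm0 lt_min d10.
have fin a : X a -> enorm (a - x) < Num.min d1 d2 -> f a \is a fin_num.
  move=> Xa ax; have [->//|/eqP ax0] := eqVneq a x.
  have := quot _ _ Xa Xx ax x0 ax0; rewrite -(fineK fx).
  have e0 : (0 < (enorm (a - x))^-1%:E)%E.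
    by rewrite lte_fin invr_gt0; apply: enorm_gt0 => /subr0_eq.
  by case: (f a) => //=; rewrite gt0_mulye.
move=> a b Xa Xb ax bx; have fa := fin a Xa ax; have fb := fin b Xb bx.
split=> //; have [->|/eqP ab] := eqVneq a b.
  by rewrite !subrr normr0 enorm0 mulr0.
have := quot _ _ Xa Xb ax bx ab; rewrite -(fineK fa) -(fineK fb) /= -EFinM lte_fin.
rewrite ltr_pdivrMr; last by apply: enorm_gt0 => /subr0_eq.
exact: ltW.
Qed.

Lemma lip_ball_le X f x L d : 0 < d -> 0 <= L -> lip_ball X f x L d ->
  (lip X f x <= L%:E)%E.
Proof.
move=> d0 L0 fL; rewrite /lip; case: asboolP => [_|_]; first by rewrite lee_fin.
pose W := [set p : 'rV[R]_n * 'rV[R]_n | [/\ X p.1, X p.2 & p.1 <> p.2] /\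
  (enorm (p.1 - x) < d /\ enorm (p.2 - x) < d)].
rewrite limf_esupE; apply: le_trans (ereal_inf_lbound _) _.
  exists W => //.
  exists ([set y | enorm (y - x) < d], [set y | enorm (y - x) < d]) => /=.
    by split; apply/nbhs_enormP; exists d.
  by move=> [a b] /= [ax bx] Dab; split.
apply: ge_ereal_sup => _ [[a b] /= [[Xa Xb ab] [ax bx]] <-].
have [fa H] := fL a b Xa Xb ax bx; have [fb _] := fL b a Xb Xa bx ax.
rewrite -(fineK fa) -(fineK fb) /= -EFinM lee_fin ler_pdivrMr//.
by apply: enorm_gt0 => /subr0_eq.
Qed.

(** Along the segment from [x] to [y] the increase of [f] is bounded both below
    by the regular subgradient and above by the Lipschitz constant. *)
Lemma regular_slope_le X f xb L d x v :
  convex_set (X : set (convex_lmodType 'rV[R]_n)) -> lip_ball X f xb L d ->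
  enorm (x - xb) < d -> regular_subdiff (plus_delta f X) x v -> slope_le X x v L.
Proof.
move=> cX fL xd /regular_subdiffP[Xx fx h] y Xy.
have [->|/eqP yx] := eqVneq y x; first by rewrite subrr dotp0r enorm0 mulr0.
have N0 : 0 < enorm (y - x) by apply: enorm_gt0 => /subr0_eq.
apply: (@le_of_approx _ _ _ (enorm (y - x))) => e e0 _.
have [r r0 hr] := h e e0.
have m0 : 0 < Num.min r (d - enorm (x - xb)) by rewrite lt_min r0 subr_gt0.
pose t := Num.min 1 (Num.min r (d - enorm (x - xb)) / (2 * enorm (y - x))).
have t0 : 0 < t by rewrite lt_min ltr01 divr_gt0// mulr_gt0.
have t1 : t <= 1 by rewrite ge_min lexx.
have tN : t * enorm (y - x) < Num.min r (d - enorm (x - xb)).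
  apply: le_lt_trans (_ : Num.min r (d - enorm (x - xb)) / 2 < _); last first.
    by rewrite ltr_pdivrMr// ltr_pMr// ltr1n.
  by rewrite -ler_pdivlMr// -mulrA -invfM ge_min lexx orbT.
move: tN; rewrite lt_min => /andP[tr td].
pose z := x + t *: (y - x).
have zx : z - x = t *: (y - x) by rewrite addrC addKr.
have Nz : enorm (z - x) = t * enorm (y - x) by rewrite zx enormZ gtr0_norm.
have Xz : X z by apply: convex_segment => //; exact: ltW.
have zd : enorm (z - xb) < d.
  by apply: le_lt_trans (enorm_sub_triangle _ _ x) _; rewrite Nz -ltrBrDr.
have [fz H] := fL z x Xz Xx zd xd.
have := hr z Xz; rewrite Nz => /(_ tr); rewrite -(fineK fz) lee_fin zx dotpZr => H2.
have H3 : t * dotp v (y - x) <= t * (L * enorm (y - x) + e * enorm (y - x)).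
  move: H; rewrite Nz => /(le_trans (ler_norm _)); lra.
by rewrite ler_pM2l// in H3.
Qed.

Lemma subdiff_slope_le X f xb L d x v :
  convex_set (X : set (convex_lmodType 'rV[R]_n)) -> 0 <= L ->
  lip_ball X f xb L d -> enorm (x - xb) < d ->
  subdiff (plus_delta f X) x v -> slope_le X x v L.
Proof.
move=> cX L0 fL xd /subdiffP[_ h]; apply: slope_le_closed => // e e0.
have m0 : 0 < Num.min e (d - enorm (x - xb)) by rewrite lt_min e0 subr_gt0.
have [y [z []]] := h _ m0; rewrite !lt_min => /andP[ye yd] _ rz /andP[ze _].
exists y, z, L; split=> //; first by rewrite lerDl ltW.
apply: regular_slope_le rz => //.
  exact: fL.
by apply: le_lt_trans (enorm_sub_triangle _ _ x) _; rewrite -ltrBrDr.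
Qed.

Lemma proj_subdiff_le X f xb L d x w :
  convex_set (X : set (convex_lmodType 'rV[R]_n)) -> 0 <= L ->
  lip_ball X f xb L d -> enorm (x - xb) < d ->
  proj_subdiff X f x w -> enorm w <= L.
Proof.
move=> cX L0 fL xd /proj_subdiffP[_ [_ h]]; apply: (@le_of_approx _ _ _ 1) => e e0 _.
have m0 : 0 < Num.min e (d - enorm (x - xb)) by rewrite lt_min e0 subr_gt0.
have [y [v [p []]]] := h _ m0; rewrite !lt_min => /andP[_ yd] _ sv pp /andP[pe _].
rewrite mulr1; apply: le_trans (enorm_le_dist w p) _; apply: lerD.
  apply: proj_le_slope pp => //; apply: (subdiff_slope_le cX L0 fL) sv.
  by apply: le_lt_trans (enorm_sub_triangle _ _ x) _; rewrite -ltrBrDr.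
by rewrite enorm_subC ltW.
Qed.

End LipschitzModulus.

(** * Penalized minimization *)

Section PenalizedMinima.
Context {R : realType} {n : nat}.
Implicit Types (x y z v w p a b : 'rV[R]_n) (S X : set 'rV[R]_n).
Implicit Types (f : 'rV[R]_n -> \bar R).

(** The last hypothesis expresses that [S] is closed and that [h] is lower
    semicontinuous on it. *)
Lemma min_attained S (h : 'rV[R]_n -> R) a M m0 : S a ->
  (forall z, S z -> enorm z <= M) -> (forall z, S z -> m0 <= h z) ->
  (forall y m, (forall e, 0 < e ->
     exists z, [/\ S z, enorm (z - y) < e & h z <= m + e]) -> S y /\ h y <= m) ->
  exists2 y, S y & forall z, S z -> h y <= h z.
Proof.
move=> Sa SM hm0 lsc; pose m := inf (h @` S).
have inS : has_inf (h @` S).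
  by split; [exists (h a), a|exists m0 => _ [z Sz <-]; exact: hm0].
have /choose_approx[u_ hu] : forall e, 0 < e -> exists z, S z /\ h z < m + e.
  by move=> e e0; have [_ [z Sz <-] zm] := inf_adherent e0 inS; exists z.
have [y hy] := bounded_cluster (fun k => SM _ (proj1 (hu k))).
have [Sy ym] : S y /\ h y <= m.
  apply: lsc => e e0; have [N _ hN] := near_invS_lt e0.
  have [k Nk ky] := hy e N e0; exists (u_ k); have [Su um] := hu k; split=> //.
  by apply: le_trans (ltW um) _; rewrite lerD2l ltW//; exact: hN.
exists y => // z Sz; apply: le_trans ym _; apply: ge_inf; last by exists z.
by case: inS.
Qed.

(** A sublevel set at a level below [f x] is closed near [x] and misses [x]. *)
Lemma lsc_lower f x eta : f x \is a fin_num -> locally_lsc f x -> 0 < eta ->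
  exists2 r, 0 < r & forall y, enorm (y - x) < r -> ((fine (f x) - eta)%:E < f y)%E.
Proof.
move=> fx [e e0 cl] eta0; apply: contrapT => H.
have /cl c : ((fine (f x) - eta)%:E <= f x + e%:E)%E.
  by rewrite -{2}(fineK fx) -EFinD lee_fin; lra.
have : [set y | enorm (y - x) <= e /\ (f y <= (fine (f x) - eta)%:E)%E] x.
  apply: closed_enorm c _ => d d0; apply: contrapT => H2; apply: H.
  exists (Num.min d e); first by rewrite lt_min d0.
  move=> y; rewrite lt_min => /andP[yd ye]; rewrite ltNge; apply/negP => fy.
  by apply: H2; exists y => //; split=> //; exact: ltW.
by case=> _; rewrite -{1}(fineK fx) lee_fin; lra.
Qed.

(** Only sublevel sets at levels up to [f x + e] are known to be closed, so the
    minimization takes place on such a sublevel set; outside it the penalized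
    function exceeds its value at [a]. *)
Lemma penalized_min X f x e r m0 (theta : 'rV[R]_n -> R) a :
  closed X -> f x \is a fin_num ->
  (forall l : R, (l%:E <= f x + e%:E)%E ->
    closed [set y | enorm (y - x) <= e /\ (f y <= l%:E)%E]) ->
  r <= e -> (forall y, enorm (y - x) <= r -> (m0%:E <= f y)%E) ->
  (forall y, 0 <= theta y) ->
  (forall y eps, 0 < eps -> exists2 d, 0 < d &
     forall z, enorm (z - y) < d -> theta y - eps <= theta z) ->
  X a -> enorm (a - x) <= r -> f a \is a fin_num ->
  fine (f a) + theta a <= fine (f x) + e ->
  exists y, [/\ X y /\ f y \is a fin_num, enorm (y - x) <= r,
    fine (f y) + theta y <= fine (f a) + theta a &
    forall z, X z -> enorm (z - x) <= r ->
      ((fine (f y) + theta y - theta z)%:E <= f z)%E].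
Proof.
move=> cX fx cl re fm0 th0 thc Xa ax fa ha.
pose S := [set z | [/\ X z, enorm (z - x) <= r & (f z <= (fine (f x) + e)%:E)%E]].
have Sfin z : S z -> f z \is a fin_num.
  move=> [_ zr fz]; have := fm0 z zr; move: fz.
  by case: (f z) => //; rewrite ?leeNy_eq ?leye_eq.
have Sa : S a.
  split=> //; rewrite -(fineK fa) lee_fin; apply: le_trans ha.
  by rewrite lerDl.
have [|||y Sy ymin] := @min_attained S (fun z => fine (f z) + theta z) a
  (enorm x + r) m0 Sa.
- move=> z [_ zr _]; apply: le_trans (enorm_le_dist z x) _.
  by rewrite lerD2l.
- move=> z Sz; have := fm0 z; case: (Sz) => _ zr _ /(_ zr).
  by rewrite -(fineK (Sfin z Sz)) lee_fin => /le_trans; apply; rewrite lerDl.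
- move=> y m h.
  have Xy : X y.
    by apply: closed_enorm cX _ => d d0; have [z [[Xz _ _] zy _]] := h d d0; exists z.
  have yr : enorm (y - x) <= r.
    apply: (@le_of_approx _ _ _ 1) => d d0 _; have [z [[_ zr _] zy _]] := h d d0.
    apply: le_trans (enorm_sub_triangle _ _ z) _.
    by rewrite addrC mulr1 lerD// enorm_subC ltW.
  have level l : l <= fine (f x) + e ->
      (forall d, 0 < d -> exists z, [/\ S z, enorm (z - y) < d & (f z <= l%:E)%E]) ->
      (f y <= l%:E)%E.
    move=> le H; have /cl c : (l%:E <= f x + e%:E)%E.
      by rewrite -(fineK fx) -EFinD lee_fin.
    have [] : [set y | enorm (y - x) <= e /\ (f y <= l%:E)%E] y; last by [].
    apply: closed_enorm c _ => d d0; have [z [[_ zr _] zy fz]] := H d d0.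
    by exists z => //; split=> //; exact: le_trans re.
  have fy : (f y <= (fine (f x) + e)%:E)%E.
    apply: level => // d d0; have [z [Sz zy _]] := h d d0.
    by exists z; split=> //; case: Sz.
  have Sy : S y by split.
  split=> //; rewrite -lerBrDr; apply/ler_addgt0Pr => eps eps0.
  rewrite -lee_fin fineK ?Sfin//.
  have [big|small] := leP (fine (f x) + e) (m - theta y + eps).
    by apply: le_trans fy _; rewrite lee_fin.
  apply: level => [|d d0]; first exact: ltW.
  have e20 : 0 < eps / 2 by rewrite divr_gt0.
  have [d' d'0 hd'] := thc y _ e20.
  have m1 : 0 < Num.min d (Num.min d' (eps / 2)) by rewrite !lt_min d0 d'0.
  have [z [Sz]] := h _ m1; rewrite !lt_min => /andP[zd /andP[zd' _]] zm.
  exists z; split=> //; rewrite -(fineK (Sfin z Sz)) lee_fin.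
  have := hd' z zd'.
  have : Num.min d (Num.min d' (eps / 2)) <= eps / 2 by rewrite !ge_min lexx !orbT.
  lra.
exists y; have [Xy yr fy] := Sy; split=> //.
- by split=> //; exact: Sfin.
- exact: ymin.
- move=> z Xz zr; have [fz|fz] := leP (f z) (fine (f x) + e)%:E.
    have Sz : S z by split.
    by rewrite -(fineK (Sfin z Sz)) lee_fin lerBlDr; exact: ymin.
  apply: le_trans (ltW fz); rewrite lee_fin; apply: le_trans ha.
  by have := ymin a Sa; have := th0 z; rewrite /=; lra.
Qed.

(** A quadratic penalty is smooth with gradient [2 q (z - b)], so at a minimizer
    the opposite of this gradient is a regular (even proximal) subgradient. *)
Lemma quadratic_min_subgradient X f y b q r : X y -> f y \is a fin_num ->
  0 <= q -> 0 < r ->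
  (forall z, X z -> enorm (z - y) < r ->
    ((fine (f y) + q * enorm (y - b) ^+ 2 - q * enorm (z - b) ^+ 2)%:E <= f z)%E) ->
  regular_subdiff (plus_delta f X) y ((2 * q) *: (b - y)).
Proof.
move=> Xy fy q0 r0 h; apply/regular_subdiffP; split=> // e e0.
have q1 : 0 < q + 1 by rewrite ltr_wpDl.
exists (Num.min r (e / (q + 1))); first by rewrite lt_min r0 divr_gt0.
move=> z Xz; rewrite lt_min => /andP[zr zq]; apply: le_trans (h z Xz zr).
rewrite lee_fin -!addrA lerD2l.
have -> : z - b = (z - y) + (y - b) by rewrite addrA subrK.
have Z0 := enorm_ge0 (z - y).
have : q * enorm (z - y) ^+ 2 <= e * enorm (z - y).
  rewrite expr2 mulrA ler_wpM2r// ltW//.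
  move: zq; rewrite ltr_pdivlMr//; nra.
by rewrite !enorm_sqr !dotp_linE [dotp y z]dotpC [dotp b z]dotpC [dotp b y]dotpC; lra.
Qed.

End PenalizedMinima.

(** * Steep tangent subgradients *)

Section SteepSubgradients.
Context {R : realType} {n : nat} (X : set 'rV[R]_n) (f : 'rV[R]_n -> \bar R).
Context (x : 'rV[R]_n).
Implicit Types (y z v w p a b : 'rV[R]_n).
Context (X_convex : convex_set (X : set (convex_lmodType 'rV[R]_n))).

(** The subgradients are required to be tangent, so that they coincide with their
    projections, and regular, as this is what penalized minimization yields. *)
Definition steep d K := exists y v,
  [/\ enorm (y - x) < d, `|fine (f y) - fine (f x)| < d,
      regular_subdiff (plus_delta f X) y v, tangent_cone X y v & K <= enorm v].

Let penalty K C b z : R := K * enorm (z - b) + C * enorm (z - b) ^+ 2.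

Lemma penalty_ge0 K C b z : 0 <= K -> 0 <= C -> 0 <= penalty K C b z.
Proof. by move=> K0 C0; rewrite addr_ge0 ?mulr_ge0 ?sqr_ge0 ?enorm_ge0. Qed.

Lemma penalty_lsc K C b y eps : 0 <= K -> 0 <= C -> 0 < eps ->
  exists2 d, 0 < d &
    forall z, enorm (z - y) < d -> penalty K C b y - eps <= penalty K C b z.
Proof.
move=> K0 C0 eps0; have D0 := enorm_ge0 (y - b).
have c0 : 0 < K + 2 * C * enorm (y - b) + 1.
  by rewrite ltr_wpDl// addr_ge0// mulr_ge0// mulr_ge0.
exists (eps / (K + 2 * C * enorm (y - b) + 1)); first exact: divr_gt0.
move=> z; rewrite ltr_pdivlMr// => zy; rewrite /penalty.
have Z0 := enorm_ge0 (z - b); have t0 := enorm_ge0 (z - y).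
have DZ : enorm (y - b) <= enorm (z - b) + enorm (z - y).
  by rewrite (le_trans (enorm_sub_triangle _ _ z))// addrC lerD2l enorm_subC.
have A1 : K * enorm (y - b) <= K * enorm (z - b) + K * enorm (z - y).
  by rewrite -mulrDr ler_wpM2l.
have A2 : enorm (y - b) ^+ 2 - 2 * enorm (y - b) * enorm (z - y)
    <= enorm (z - b) ^+ 2.
  by have := sqr_ge0 (enorm (z - b) - enorm (y - b)); nra.
have := ler_wpM2l C0 A2; lra.
Qed.

(** The distance to [b] lies below the quadratic function touching it at [y], so
    the penalty can be replaced by a quadratic one.  The resulting subgradient
    points from [y] towards [b], a direction tangent to the convex set [X]: it
    is its own projection, and its norm is the slope of the penalty. *)
Lemma penalized_min_steep y b K C r : X y -> X b -> f y \is a fin_num ->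
  0 <= K -> 0 <= C -> 0 < r -> y <> b \/ K = 0 ->
  (forall z, X z -> enorm (z - y) < r ->
    ((fine (f y) + penalty K C b y - penalty K C b z)%:E <= f z)%E) ->
  exists v, [/\ regular_subdiff (plus_delta f X) y v, tangent_cone X y v &
                K <= enorm v].
Proof.
move=> Xy Xb fy K0 C0 r0 yb h.
have [s0|s0] := eqVneq (enorm (y - b)) 0.
  have Kz : K = 0 by case: yb => // -[]; exact/subr0_eq/enorm0_eq0.
  exists ((2 * C) *: (b - y)); split.
  - apply: quadratic_min_subgradient r0 _ => // z Xz zr; apply: le_trans (h z Xz zr).
    by rewrite /penalty Kz lee_fin !mul0r !add0r.
  - by apply: tangent_direction => //; rewrite mulr_ge0.
  - by rewrite Kz enorm_ge0.
have {}s0 : 0 < enorm (y - b) by rewrite lt_neqAle eq_sym s0 enorm_ge0.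
set s := enorm (y - b) in s0 *.
have q0 : 0 <= C + K / (2 * s) by rewrite addr_ge0// divr_ge0// mulr_ge0// ltW.
exists ((2 * (C + K / (2 * s))) *: (b - y)); split.
- apply: quadratic_min_subgradient r0 _ => // z Xz zr; apply: le_trans (h z Xz zr).
  rewrite lee_fin -!addrA lerD2l /penalty -/s.
  have -> : (C + K / (2 * s)) * s ^+ 2 = C * s ^+ 2 + K * s / 2.
    by field; rewrite gt_eqF.
  suff : K * enorm (z - b) <= K * s / 2 + K / (2 * s) * enorm (z - b) ^+ 2 by lra.
  have -> : K * s / 2 + K / (2 * s) * enorm (z - b) ^+ 2 =
      K * enorm (z - b) + K / (2 * s) * (enorm (z - b) - s) ^+ 2.
    by field; rewrite gt_eqF.
  by rewrite lerDl mulr_ge0 ?sqr_ge0// divr_ge0// mulr_ge0// ltW.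
- by apply: tangent_direction => //; rewrite mulr_ge0.
- rewrite enormZ enorm_subC -/s ger0_norm ?mulr_ge0//.
  have -> : 2 * (C + K / (2 * s)) * s = 2 * C * s + K by field; rewrite gt_eqF.
  by rewrite lerDr !mulr_ge0// ltW.
Qed.

Context (X_closed : closed X).
Context (Xx : X x).
Context (f_fin : f x \is a fin_num).
Context (f_lsc : locally_lsc f x).

(** The constant [C] is chosen so large that the quadratic part of the penalty
    keeps the minimizer [y] inside the ball on which [f] is bounded below; the
    bounds on [rho] make the penalty at [a] negligible. *)
Lemma penalized_minimizer d K : 0 < d -> 0 <= K ->
  exists C rho eta, [/\ 0 <= C, 0 < rho, 0 < eta,
    K * (2 * rho) + C * (2 * rho) ^+ 2 <= eta &
    forall a b, X a -> X b -> enorm (a - x) < rho -> enorm (b - x) < rho ->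
      f a \is a fin_num -> fine (f a) <= fine (f x) + eta ->
      exists y, [/\ enorm (y - x) < d, `|fine (f y) - fine (f x)| < d,
        f y \is a fin_num, fine (f y) + penalty K C b y <=
          fine (f a) + penalty K C b a &
        y <> b \/ K = 0 -> exists v, [/\ regular_subdiff (plus_delta f X) y v,
          tangent_cone X y v & K <= enorm v]]].
Proof.
move=> d0 K0; have [e e0 cl] := f_lsc.
pose eta := Num.min d e / 3.
have eta0 : 0 < eta by rewrite divr_gt0// lt_min d0.
have etad : 3 * eta <= d by rewrite mulrC divfK// ge_min lexx.
have etae : 3 * eta <= e by rewrite mulrC divfK// ge_min lexx orbT.
have [r1 r10 fr1] := lsc_lower f_fin f_lsc eta0.
pose r := Num.min (Num.min r1 d / 2) e.
have r0 : 0 < r by rewrite lt_min divr_gt0// lt_min r10.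
have re : r <= e by rewrite ge_min lexx orbT.
have rm : r < Num.min r1 d.
  apply: le_lt_trans (_ : Num.min r1 d / 2 < _); first by rewrite ge_min lexx.
  by rewrite ltr_pdivrMr// ltr_pMr ?ltr1n// lt_min r10.
move: rm; rewrite lt_min => /andP[rr1 rd].
pose C := 16 * eta / r ^+ 2.
have C0 : 0 <= C by rewrite divr_ge0 ?sqr_ge0// mulr_ge0// ltW.
have Cr : C * r ^+ 2 = 16 * eta by rewrite divfK// gt_eqF// exprn_gt0.
pose rho := Num.min (r / 16) (eta / (4 * (K + 1))).
have K1 : 0 < 4 * (K + 1) by rewrite mulr_gt0// ltr_wpDl.
have rho0 : 0 < rho by rewrite lt_min; apply/andP; split; exact: divr_gt0.
have rhor : 16 * rho <= r.
  by rewrite mulrC -ler_pdivlMr// ge_min lexx.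
have rhoK : rho * (4 * (K + 1)) <= eta.
  by rewrite -ler_pdivlMr// ge_min lexx orbT.
have rhoC : C * (16 * rho) ^+ 2 <= 16 * eta.
  rewrite -Cr ler_wpM2l// ler_sqr ?nnegrE// ?mulr_ge0// ltW//.
have small : K * (2 * rho) + C * (2 * rho) ^+ 2 <= eta.
  by rewrite exprMn in rhoC; rewrite exprMn; nra.
exists C, rho, eta; split=> // a b Xa Xb ax bx fa fax.
have ab : enorm (a - b) <= 2 * rho.
  apply: le_trans (enorm_sub_triangle _ _ x) _; rewrite [enorm (x - b)]enorm_subC; lra.
have pa : penalty K C b a <= eta.
  apply: le_trans small; apply: lerD; first by rewrite ler_wpM2l.
  by rewrite ler_wpM2l// ler_sqr ?nnegrE ?enorm_ge0 ?mulr_ge0// ltW.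
have [||||||y [[Xy fy] yr ya ymin]] := @penalized_min _ _ X f x e r (fine (f x) - eta)
  (penalty K C b) a X_closed f_fin cl re _ _ _ Xa.
- by move=> y yr; apply/ltW/fr1; exact: le_lt_trans rr1.
- by move=> y; exact: penalty_ge0.
- by move=> y eps; exact: penalty_lsc.
- by apply: le_trans (ltW ax) _; lra.
- exact: fa.
- lra.
exists y.
have fyl : fine (f x) - eta < fine (f y).
  by rewrite -lte_fin (fineK fy); apply: fr1; exact: le_lt_trans rr1.
have p0 := penalty_ge0 b y K0 C0.
have py : penalty K C b y <= 3 * eta by lra.
have yb : enorm (y - b) < r / 2.
  rewrite ltNge; apply/negP => H.
  have : C * (r / 2) ^+ 2 <= penalty K C b y.
    rewrite /penalty; apply: ler_wpDl; first by rewrite mulr_ge0 ?enorm_ge0.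
    by rewrite ler_wpM2l// ler_sqr ?nnegrE ?enorm_ge0// divr_ge0// ltW.
  by rewrite exprMn mulrA Cr; lra.
have yx : enorm (y - x) < r.
  by apply: le_lt_trans (enorm_sub_triangle _ _ b) _; lra.
split=> //.
- exact: lt_trans rd.
- by rewrite ltr_norml; apply/andP; split; lra.
- move=> ybK; have t0 : 0 < r - enorm (y - x) by rewrite subr_gt0.
  apply: (penalized_min_steep (C := C) Xy Xb fy K0 C0 t0 ybK) => // z Xz zy.
  apply: ymin => //.
  by apply: le_trans (enorm_sub_triangle _ _ y) _; lra.
Qed.

(** Without the linear part of the penalty, [y = b] is harmless: the subgradient is
    then 0.  This gives tangent subgradients at points arbitrarily close to [x]. *)
Lemma steep0 d : 0 < d -> steep d 0.
Proof.
move=> d0; have [C [rho [eta [_ rho0 eta0 _ h]]]] := penalized_minimizer d0 (lexx 0).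
have xx : enorm (x - x) < rho by rewrite subrr enorm0.
have [|y [yx fyx _ _ [|v [rv tv nv]]]] := h x x Xx Xx xx xx f_fin.
- by rewrite lerDl ltW.
- by right.
- by exists y, v.
Qed.

(** In the absence of steep subgradients the minimizer must be [b] itself.  With
    [a = x] this bounds [f b] from above, which then allows any [a] near [x]. *)
Lemma not_steep_bound d K : 0 < d -> 0 <= K -> ~ steep d K ->
  exists C rho, [/\ 0 <= C, 0 < rho &
    forall a b, X a -> X b -> enorm (a - x) < rho -> enorm (b - x) < rho ->
      f b \is a fin_num /\
      fine (f b) <= fine (f a) + K * enorm (a - b) + C * enorm (a - b) ^+ 2].
Proof.
move=> d0 K0 nst; have [C [rho [eta [C0 rho0 eta0 sm h]]]] := penalized_minimizer d0 K0.
exists C, rho; split=> //.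
have key a b : X a -> X b -> enorm (a - x) < rho -> enorm (b - x) < rho ->
    f a \is a fin_num -> fine (f a) <= fine (f x) + eta ->
    f b \is a fin_num /\
    fine (f b) <= fine (f a) + K * enorm (a - b) + C * enorm (a - b) ^+ 2.
  move=> Xa Xb ax bx fa fax; have [y [yx fyx fy fya hs]] := h a b Xa Xb ax bx fa fax.
  have yb : y = b.
    apply: contrapT => yb; apply: nst.
    by have [|v [rv tv nv]] := hs; [left|exists y, v].
  rewrite yb in fy fya; split=> //; move: fya.
  by rewrite /penalty subrr enorm0 expr0n !mulr0 !addr0 addrA.
move=> a b Xa Xb ax bx.
have xx : enorm (x - x) < rho by rewrite subrr enorm0.
have [|fa fax] := key x a Xx Xa xx ax f_fin; first by rewrite lerDl ltW.
apply: key => //; apply: le_trans fax _; rewrite -addrA lerD2l; apply: le_trans sm.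
have xa : enorm (x - a) <= 2 * rho.
  by rewrite enorm_subC; apply: le_trans (ltW ax) _; rewrite ler_peMl ?ler1n// ltW.
apply: lerD; first by rewrite ler_wpM2l.
by rewrite ler_wpM2l// ler_sqr ?nnegrE ?enorm_ge0 ?mulr_ge0// ltW.
Qed.

Lemma not_steep_lip_ball d K K' : 0 < d -> 0 <= K -> ~ steep d K -> K < K' ->
  exists2 rho, 0 < rho & lip_ball X f x K' rho.
Proof.
move=> d0 K0 nst KK'; have [C [rho [C0 rho0 h]]] := not_steep_bound d0 K0 nst.
have c0 : 0 < 2 * (C + 1) by rewrite mulr_gt0// ltr_wpDl.
exists (Num.min rho ((K' - K) / (2 * (C + 1)))).
  by rewrite lt_min rho0 divr_gt0// subr_gt0.
have one a b : X a -> X b ->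
    enorm (a - x) < Num.min rho ((K' - K) / (2 * (C + 1))) ->
    enorm (b - x) < Num.min rho ((K' - K) / (2 * (C + 1))) ->
    f b \is a fin_num /\ fine (f b) <= fine (f a) + K' * enorm (a - b).
  rewrite !lt_min => Xa Xb /andP[ax axC] /andP[bx bxC].
  have [fb H] := h a b Xa Xb ax bx; split=> //; apply: le_trans H _.
  rewrite -addrA lerD2l expr2 mulrA -mulrDl ler_wpM2r ?enorm_ge0//.
  have ab : enorm (a - b) <= enorm (a - x) + enorm (b - x).
    by rewrite [enorm (b - x)]enorm_subC; exact: enorm_sub_triangle.
  move: axC bxC; rewrite !ltr_pdivlMr// => axC bxC.
  have := ler_wpM2l C0 ab; have := enorm_ge0 (a - x); have := enorm_ge0 (b - x).
  lra.
move=> a b Xa Xb ax bx; have [fb H1] := one a b Xa Xb ax bx.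
have [fa H2] := one b a Xb Xa bx ax; split=> //.
rewrite enorm_subC in H2; rewrite ler_norml; apply/andP; split; lra.
Qed.

(** Tangent subgradients are their own projections, and the Lipschitz constant
    bounds them, so steeper and steeper ones have a limit. *)
Lemma steep_limit m L d : lip_ball X f x L d -> 0 <= L -> 0 < d ->
  (forall e, 0 < e -> steep e (m - e)) ->
  exists2 u, proj_subdiff X f x u & m <= enorm u.
Proof.
move=> fL L0 d0 h.
have /choose_approx[s hs] : forall e, 0 < e -> exists s : 'rV[R]_n * 'rV[R]_n,
    [/\ enorm (s.1 - x) < e /\ enorm (s.1 - x) < d,
        `|fine (f s.1) - fine (f x)| < e,
        regular_subdiff (plus_delta f X) s.1 s.2, tangent_cone X s.1 s.2 &
        m - e <= enorm s.2].
  move=> e e0; have m0 : 0 < Num.min e d by rewrite lt_min e0.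
  have [y [v []]] := h _ m0; rewrite !lt_min => /andP[ye yd] /andP[fe _] rv tv nv.
  exists (y, v); split=> //; apply: le_trans nv; rewrite lerD2l lerN2.
  by rewrite ge_min lexx.
have sub k : subdiff (plus_delta f X) (s k).1 (s k).2.
  by have [_ _ rv _ _] := hs k; exact: regular_subdiff_subdiff.
have bnd k : enorm (s k).2 <= L.
  have [[_ yd] _ _ tv _] := hs k.
  apply: proj_le_slope (proj_self tv) => //.
  exact: (subdiff_slope_le X_convex L0 fL yd (sub k)).
have [u hu] := bounded_cluster bnd.
have approx e : 0 < e -> exists2 k, k.+1%:R^-1 < e & enorm ((s k).2 - u) < e.
  move=> e0; have [N _ hN] := near_invS_lt e0; have [k Nk ku] := hu e N e0.
  by exists k => //; exact: hN.
exists u.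
  apply/proj_subdiffP; split=> //; split=> // e e0.
  have [k ke ku] := approx e e0; have [[yx _] fyx _ tv _] := hs k.
  exists (s k).1, (s k).2, (s k).2; split=> //.
  - exact: lt_trans ke.
  - exact: lt_trans ke.
  - exact: proj_self.
apply: (@le_of_approx _ _ _ 2) => e e0 _.
have [k ke ku] := approx e e0; have [_ _ _ _ nv] := hs k.
have := enorm_le_dist (s k).2 u; move: ke nv; move: (k.+1%:R^-1) => q; lra.
Qed.

Lemma horizon_proj_subdiff0 : horizon_proj_subdiff X f x 0.
Proof.
apply/horizon_proj_subdiffP; split=> //; split=> // e e0.
have [y [v [yx fyx rv tv _]]] := steep0 e0; have N0 := enorm_ge0 v.
have c0 : 0 < 2 * (enorm v + 1) by rewrite mulr_gt0// ltr_wpDl.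
have l0 : 0 < e / (2 * (enorm v + 1)) by rewrite divr_gt0.
exists y, v, v, (e / (2 * (enorm v + 1))); split=> //.
- exact: regular_subdiff_subdiff.
- exact: proj_self.
- by rewrite l0 ltr_pdivrMr// ltr_pMr//; lra.
- rewrite subr0 enormZ gtr0_norm// mulrAC ltr_pdivrMr// ltr_pM2l//; lra.
Qed.

(** Projected subgradients that are ever steeper, once normalized, accumulate at
    a unit horizon projectional subgradient. *)
Lemma horizon_trivial_not_steep : horizon_proj_subdiff X f x = [set 0] ->
  exists d K, [/\ 0 < d, 0 <= K & ~ steep d K].
Proof.
move=> H; apply: contrapT => nex.
have /choose_approx[s hs] : forall e, 0 < e -> exists s : 'rV[R]_n * 'rV[R]_n,
    [/\ enorm (s.1 - x) < e, `|fine (f s.1) - fine (f x)| < e,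
        regular_subdiff (plus_delta f X) s.1 s.2, tangent_cone X s.1 s.2 &
        e^-1 <= enorm s.2].
  move=> e e0; have [y [v ?]] : steep e e^-1.
    by apply: contrapT => nst; apply: nex; exists e, e^-1; rewrite invr_ge0 (ltW e0).
  by exists (y, v).
have v0 k : 0 < enorm (s k).2.
  by have [_ _ _ _] := hs k; apply: lt_le_trans; rewrite invrK.
pose u_ k := (enorm (s k).2)^-1 *: (s k).2.
have u1 k : enorm (u_ k) = 1.
  by rewrite enormZ gtr0_norm ?invr_gt0// mulVf// gt_eqF.
have [|u hu] := @bounded_cluster _ _ u_ 1; first by move=> k; rewrite u1.
have : horizon_proj_subdiff X f x u.
  apply/horizon_proj_subdiffP; split=> //; split=> // e e0.
  have [N _ hN] := near_invS_lt e0; have [k /hN /= ke ku] := hu e N e0.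
  have [yx fyx rv tv nv] := hs k.
  exists (s k).1, (s k).2, (s k).2, (enorm (s k).2)^-1; split=> //.
  - by split; exact: lt_trans ke.
  - exact: regular_subdiff_subdiff.
  - exact: proj_self.
  - rewrite invr_gt0 v0/=; apply: le_lt_trans ke.
    by by rewrite -[leRHS]invrK lef_pV2 ?posrE ?invr_gt0.
rewrite H => u0; have [k _] := hu 1 0%N ltr01.
by rewrite u0 subr0 u1 ltxx.
Qed.

End SteepSubgradients.

(** * Normals to the epigraph *)

Section RowPairs.
Context {R : realType} {n : nat}.
Implicit Types (y z w v : 'rV[R]_n) (a b : R).

(** The points of the space that contains the graph of the profile mapping, with
    the last coordinate as a scalar. *)
Definition pair_row y a : 'rV[R]_(n + 1) := row_mx y (const_mx a).

Lemma pair_rowE (u : 'rV[R]_(n + 1)) : exists y a, u = pair_row y a.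
Proof.
exists (lsubmx u), (rsubmx u 0 0); rewrite -[LHS]hsubmxK; congr row_mx.
by apply/rowP => i; rewrite [RHS]mxE (ord1 i).
Qed.

Lemma pair_rowB y z a b : pair_row y a - pair_row z b = pair_row (y - z) (a - b).
Proof.
by rewrite /pair_row opp_row_mx add_row_mx; congr row_mx; apply/rowP => i; rewrite !mxE.
Qed.

Lemma pair_rowD y z a b t :
  pair_row y a + t *: pair_row z b = pair_row (y + t *: z) (a + t * b).
Proof.
rewrite /pair_row scale_row_mx add_row_mx; congr row_mx.
by apply/rowP => i; rewrite !mxE.
Qed.

Lemma dotp_pair_row y z a b : dotp (pair_row y a) (pair_row z b) = dotp y z + a * b.
Proof.
rewrite /dotp /pair_row tr_row_mx mul_row_col mxE; congr (_ + _).
by rewrite mxE big_ord1 !mxE.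
Qed.

Lemma enorm_pair_row y a : enorm (pair_row y a) ^+ 2 = enorm y ^+ 2 + a ^+ 2.
Proof. by rewrite !enorm_sqr dotp_pair_row expr2. Qed.

Lemma enorm_pair_row_l y a : enorm y <= enorm (pair_row y a).
Proof.
by rewrite -ler_sqr ?nnegrE ?enorm_ge0// enorm_pair_row lerDl sqr_ge0.
Qed.

Lemma enorm_pair_row_r y a : `|a| <= enorm (pair_row y a).
Proof.
rewrite -ler_sqr ?nnegrE ?enorm_ge0// enorm_pair_row real_normK ?num_real//.
by rewrite lerDr sqr_ge0.
Qed.

Lemma enorm_pair_row_le y a : enorm (pair_row y a) <= enorm y + `|a|.
Proof.
rewrite -ler_sqr ?nnegrE ?addr_ge0 ?enorm_ge0// enorm_pair_row sqrrD.
rewrite [`|a| ^+ 2]real_normK ?num_real// lerD2r lerDl.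
by rewrite mulrn_wge0// mulr_ge0 ?enorm_ge0.
Qed.

Lemma enorm_const a : enorm (const_mx a : 'rV[R]_1) = `|a|.
Proof. by rewrite /enorm dotpE big_ord1 !mxE -expr2 sqrtr_sqr. Qed.

Lemma const_mxB a b : const_mx a - const_mx b = const_mx (a - b) :> 'rV[R]_1.
Proof. by apply/rowP => i; rewrite !mxE. Qed.

Lemma const_mxN a : - const_mx a = const_mx (- a) :> 'rV[R]_1.
Proof. by apply/rowP => i; rewrite !mxE. Qed.

Lemma row1_const (u : 'rV[R]_1) : u = const_mx (u 0 0).
Proof. by apply/rowP => i; rewrite mxE (ord1 i). Qed.

(** Continuity of [(b, w) |-> w / b] at [(l, v)]. *)
Lemma scale_approx l v e : 0 < l -> 0 < e ->
  exists2 d, 0 < d & forall b w, `|b - l| < d -> enorm (w - v) < d ->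
    0 < b /\ enorm (b^-1 *: w - l^-1 *: v) < e.
Proof.
move=> l0 e0; have N0 := enorm_ge0 v.
have c0 : 0 < 2 * (l + enorm v) by rewrite mulr_gt0// ltr_pwDl.
exists (Num.min (l / 2) (e * l ^+ 2 / (2 * (l + enorm v)))).
  by rewrite lt_min !divr_gt0// mulr_gt0// exprn_gt0.
move=> b w; rewrite !lt_min => /andP[bl be] /andP[_ we].
have lb : l / 2 < b by move: bl; rewrite ltr_norml => /andP[]; lra.
have b0 : 0 < b by apply: lt_trans lb; rewrite divr_gt0.
split=> //; have -> : b^-1 *: w - l^-1 *: v =
    b^-1 *: ((w - v) + ((l - b) / l) *: v).
  by apply/rowP => i; rewrite !mxE; field; rewrite !gt_eqF.
rewrite enormZ gtr0_norm ?invr_gt0// mulrC ltr_pdivrMr//.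
apply: le_lt_trans (enorm_triangle _ _) _; rewrite enormZ normrM distrC.
rewrite [`|l^-1|]gtr0_norm ?invr_gt0// -(ltr_pM2l l0).
have -> : l * (enorm (w - v) + `|b - l| / l * enorm v) =
    l * enorm (w - v) + `|b - l| * enorm v by field; rewrite gt_eqF.
move: we be; rewrite !ltr_pdivlMr// => we be; have W0 := enorm_ge0 (w - v).
have A1 : l * enorm (w - v) + `|b - l| * enorm v <= e * l ^+ 2 / 2.
  have [wb|bw] := leP (enorm (w - v)) `|b - l|.
    by have := ler_wpM2l (ltW l0) wb; lra.
  by have := ler_wpM2r N0 (ltW bw); lra.
apply: le_lt_trans A1 _.
have := mulr_gt0 (mulr_gt0 e0 l0) (_ : 0 < b - l / 2); rewrite subr_gt0 => /(_ lb).
lra.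
Qed.

End RowPairs.

Lemma tangent_ray (R : realType) m (A : set 'rV[R]_m) x w r : A x -> 0 < r ->
  (forall t, 0 < t -> t < r -> A (x + t *: w)) -> tangent_cone A x w.
Proof.
move=> Ax r0 h; apply/tangent_coneP; split=> // e e0.
have m0 : 0 < Num.min r e by rewrite lt_min r0.
have mm : Num.min r e / 2 < Num.min r e by rewrite ltr_pdivrMr// ltr_pMr// ltr1n.
move: (mm); rewrite lt_min => /andP[mr me].
exists (Num.min r e / 2), w; rewrite subrr enorm0; split=> //; first exact: divr_gt0.
by apply: h => //; exact: divr_gt0.
Qed.

Section EpigraphNormals.
Context {R : realType} {n : nat} (X : set 'rV[R]_n) (f : 'rV[R]_n -> \bar R).
Implicit Types (y z w v p : 'rV[R]_n) (a b c : R).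

Let S := restrict_map (profile f) X.
Let epi := gph S.

Lemma gph_profile y a : epi (pair_row y a) <-> X y /\ (f y <= a%:E)%E.
Proof. by rewrite /epi /gph /S /restrict_map /profile /= row_mxKl row_mxKr mxE. Qed.

(** The epigraph is closed under increasing the last coordinate. *)
Lemma regular_normal_le0 y a v c :
  regular_normal_cone epi (pair_row y a) (pair_row v c) -> c <= 0.
Proof.
move=> [Ey h]; have [Xy fy] := (gph_profile _ _).1 Ey.
suff /h : tangent_cone epi (pair_row y a) (pair_row 0 1).
  by rewrite dotp_pair_row dotp0r add0r mulr1.
apply: (@tangent_ray _ _ _ _ _ 1) => // t t0 _; rewrite pair_rowD; apply/gph_profile.
rewrite scaler0 addr0; split=> //; apply: le_trans fy _.
by rewrite lee_fin mulr1 lerDl ltW.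
Qed.

(** Strictly above the graph, the downward direction is tangent as well. *)
Lemma regular_normal_above y a v c :
  regular_normal_cone epi (pair_row y a) (pair_row v c) ->
  f y \is a fin_num -> fine (f y) < a -> c = 0.
Proof.
move=> rn fy fya; apply/eqP; rewrite eq_le (regular_normal_le0 rn)/=.
have [Ey h] := rn; have [Xy _] := (gph_profile _ _).1 Ey.
have r0 : 0 < a - fine (f y) by rewrite subr_gt0.
suff /h : tangent_cone epi (pair_row y a) (pair_row 0 (-1)).
  by rewrite dotp_pair_row dotp0r add0r mulrN1 oppr_le0.
apply: tangent_ray r0 _ => // t t0 tr; rewrite pair_rowD; apply/gph_profile.
rewrite scaler0 addr0; split=> //; rewrite -(fineK fy) lee_fin; lra.
Qed.

(** Let [u = v / (- c)].  If the inequality of a regular subgradient fails for [u]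
    with tolerance [e] along some sequence, the directions of that sequence
    accumulate at a [w] for which [(w, <u, w> - e)] is tangent to the epigraph; its
    product with [(v, c)] is [- c e > 0]. *)
Lemma regular_normal_subgradient y v c : f y \is a fin_num -> c < 0 ->
  regular_normal_cone epi (pair_row y (fine (f y))) (pair_row v c) ->
  regular_subdiff (plus_delta f X) y ((- c)^-1 *: v).
Proof.
move=> fy c0 [Ey h]; have [Xy _] := (gph_profile _ _).1 Ey.
apply/regular_subdiffP; split=> // e e0; apply: contrapT => H.
set u := (- c)^-1 *: v in H.
have cu : v = (- c) *: u by rewrite scalerA divff ?scale1r// oppr_eq0 lt_eqF.
have /choose_approx[s hs] : forall d, 0 < d -> exists z,
    [/\ X z, enorm (z - y) < d &
      (f z < (fine (f y) + dotp u (z - y) - e * enorm (z - y))%:E)%E].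
  move=> d d0; apply: contrapT => H2; apply: H; exists d => // z Xz zd.
  by rewrite leNgt; apply/negP => fz; apply: H2; exists z.
have t0 k : 0 < enorm (s k - y).
  apply: enorm_gt0 => /subr0_eq ky; have [_ _] := hs k.
  by rewrite ky !subrr dotp0r enorm0 mulr0 subr0 addr0 (fineK fy) ltxx.
pose w_ k := (enorm (s k - y))^-1 *: (s k - y).
have w1 k : enorm (w_ k) = 1.
  by rewrite enormZ gtr0_norm ?invr_gt0// mulVf// gt_eqF.
have [|w hw] := @bounded_cluster _ _ w_ 1; first by move=> k; rewrite w1.
suff /h : tangent_cone epi (pair_row y (fine (f y))) (pair_row w (dotp u w - e)).
  by rewrite dotp_pair_row cu dotpZl; nra.
apply/tangent_coneP; split=> // d d0.
have U0 : 0 < enorm u + 1 by rewrite ltr_wpDl ?enorm_ge0.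
have m0 : 0 < Num.min d (d / 2 / (enorm u + 1)) by rewrite lt_min d0 !divr_gt0.
have [N _ hN] := near_invS_lt d0.
have [k /hN /= kd kw] := hw _ N m0.
have [Xs sd fs] := hs k.
exists (enorm (s k - y)), (pair_row (w_ k) (dotp u (w_ k) - e)); split=> //.
- exact: lt_trans kd.
- rewrite pair_rowB; apply: le_lt_trans (enorm_pair_row_le _ _) _.
  have -> : dotp u (w_ k) - e - (dotp u w - e) = dotp u (w_ k - w).
    by rewrite !dotp_linE; ring.
  move: kw; rewrite lt_min !ltr_pdivlMr// => /andP[_ kw].
  have W0 := enorm_ge0 (w_ k - w).
  have A1 : `|dotp u (w_ k - w)| <= enorm u * enorm (w_ k - w).
    rewrite ler_norml dotp_le andbT lerNl -dotpNr.
    by rewrite -[enorm (w_ k - w)]enormN; exact: dotp_le.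
  nra.
- rewrite pair_rowD; apply/gph_profile; rewrite mulrBr -dotpZr /w_ scalerA divff ?gt_eqF//.
  rewrite scale1r addrC subrK; split=> //; apply: le_trans (ltW fs) _.
  by rewrite lee_fin addrA [_ * e]mulrC.
Qed.

Lemma regular_subgradient_normal y v l : 0 <= l ->
  regular_subdiff (plus_delta f X) y v ->
  regular_normal_cone epi (pair_row y (fine (f y))) (pair_row (l *: v) (- l)).
Proof.
move=> l0 /regular_subdiffP[Xy fy h].
have Ey : epi (pair_row y (fine (f y))) by apply/gph_profile; rewrite fineK.
split=> // u; have [w [b ->]] := pair_rowE u => /tangent_coneP[_ tw].
rewrite dotp_pair_row dotpZl mulNr subr_le0 ler_wpM2l//.
apply: (@le_of_approx _ _ _ (enorm v + enorm w + 2)) => e e0 e1.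
have [d d0 hd] := h e e0.
have W0 := enorm_ge0 w.
have m0 : 0 < Num.min e (d / (enorm w + 1)).
  by rewrite lt_min e0 divr_gt0// ltr_wpDl.
have [t [u' []]] := tw _ m0; have [z [b' ->]] := pair_rowE u'.
rewrite pair_rowB !lt_min => t0 /andP[te td] /andP[zwe _].
rewrite pair_rowD => /gph_profile[Xz fz].
have zw : enorm (z - w) < e by apply: le_lt_trans zwe; exact: enorm_pair_row_l.
have bb : `|b' - b| < e by apply: le_lt_trans zwe; exact: enorm_pair_row_r.
have Z1 : enorm z <= enorm w + e.
  by apply: le_trans (enorm_le_dist z w) _; rewrite lerD2l ltW.
have zy : y + t *: z - y = t *: z by rewrite addrC addKr.
have := hd _ Xz; rewrite zy enormZ gtr0_norm// => hz.
have {}hz : fine (f y) + dotp v (t *: z) - e * (t * enorm z) <= fine (f y) + t * b'.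
  rewrite -lee_fin; apply: le_trans (hz _) fz.
  rewrite ltr_pdivlMr ?ltr_wpDl// in td; apply: le_lt_trans td.
  by rewrite ler_wpM2l ?(ltW t0)//; lra.
have {}hz : dotp v z - e * enorm z <= b'.
  by move: hz; rewrite dotpZr mulrCA -addrA lerD2l -mulrBr ler_pM2l.
have A1 : dotp v (w - z) <= enorm v * e.
  by apply: le_trans (dotp_le _ _) _; rewrite ler_wpM2l ?enorm_ge0// enorm_subC ltW.
have -> : dotp v w = dotp v z + dotp v (w - z) by rewrite !dotp_linE; ring.
move: bb; rewrite ltr_norml => /andP[_ bb].
have A2 : e * enorm z <= e * (enorm w + 1).
  by rewrite ler_pM2l//; lra.
lra.
Qed.

End EpigraphNormals.

(** * The projectional coderivative of the profile mapping *)

Section ProfileCoderivative.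
Context {R : realType} {n : nat} (X : set 'rV[R]_n) (f : 'rV[R]_n -> \bar R).
Context (x : 'rV[R]_n) (L d : R).
Implicit Types (y z w v p : 'rV[R]_n) (a b c l : R).
Context (X_convex : convex_set (X : set (convex_lmodType 'rV[R]_n))).
Context (L_ge0 : 0 <= L).
Context (f_lip : lip_ball X f x L d).

Let S := restrict_map (profile f) X.
Let epi := gph S.

(** Moving from [y] towards [z] in [X], the epigraph contains the ray of slope
    [L |z - y|]. *)
Lemma regular_normal_slope y a v c : enorm (y - x) < d ->
  regular_normal_cone epi (pair_row y a) (pair_row v c) -> slope_le X y v (- c * L).
Proof.
move=> yd [Ey h] z Xz; have [Xy fy] := (gph_profile _ _ _ _).1 Ey.
have [->|/eqP zy] := eqVneq z y; first by rewrite subrr dotp0r enorm0 mulr0.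
have N0 : 0 < enorm (z - y) by apply: enorm_gt0 => /subr0_eq.
have m0 : 0 < Num.min 1 ((d - enorm (y - x)) / enorm (z - y)).
  by rewrite lt_min ltr01 divr_gt0// subr_gt0.
suff /h : tangent_cone epi (pair_row y a) (pair_row (z - y) (L * enorm (z - y))).
  by rewrite dotp_pair_row; lra.
apply: tangent_ray m0 _ => // t t0; rewrite lt_min => /andP[t1 td].
rewrite pair_rowD; apply/gph_profile.
have Xt : X (y + t *: (z - y)) by apply: convex_segment => //; exact: ltW.
have yt : y + t *: (z - y) - y = t *: (z - y) by rewrite addrC addKr.
have td' : enorm (y + t *: (z - y) - x) < d.
  apply: le_lt_trans (enorm_sub_triangle _ _ y) _.
  by rewrite yt enormZ gtr0_norm// -ltrBrDr -ltr_pdivlMr.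
have [ft H] := f_lip Xt Xy td' yd; split=> //.
have [fy' _] := f_lip Xy Xt yd td'.
move: fy; rewrite -(fineK ft) -(fineK fy') !lee_fin.
move: H; rewrite yt enormZ (gtr0_norm t0) => /(le_trans (ler_norm _)); lra.
Qed.

Lemma coderivative_approx y a b v :
  coderivative S y (const_mx a) (const_mx b) v ->
  [/\ X y, (f y <= a%:E)%E & forall e, 0 < e -> exists z a' w c,
    [/\ regular_normal_cone epi (pair_row z a') (pair_row w (- c)), enorm (z - y) < e,
        `|a' - a| < e, enorm (w - v) < e & `|c - b| < e]].
Proof.
rewrite /coderivative /= const_mxN => /normal_coneP[/gph_profile[Xy fy] h].
split=> // e e0; have [u [u' []]] := h e e0.
have [z [a' ->]] := pair_rowE u; have [w [c ->]] := pair_rowE u'.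
rewrite -!/(pair_row _ _) !pair_rowB => rn zy wv; exists z, a', w, (- c).
rewrite opprK; split=> //.
- by apply: le_lt_trans zy; exact: enorm_pair_row_l.
- by apply: le_lt_trans zy; exact: enorm_pair_row_r.
- by apply: le_lt_trans wv; exact: enorm_pair_row_l.
- have -> : - c - b = - (c - - b) by ring.
  by rewrite normrN; apply: le_lt_trans wv; exact: enorm_pair_row_r.
Qed.

Lemma coderivative_ge0 y a b v :
  coderivative S y (const_mx a) (const_mx b) v -> 0 <= b.
Proof.
move=> /coderivative_approx[_ _ h].
apply: (@le_of_approx _ _ _ 1) => e e0 _; have [z [a' [w [c [rn _ _ _ cb]]]]] := h e e0.
have := regular_normal_le0 rn; rewrite oppr_le0 => c0.
by move: cb; rewrite ltr_norml => /andP[]; lra.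
Qed.

Lemma coderivative_slope y a b v : enorm (y - x) < d ->
  coderivative S y (const_mx a) (const_mx b) v -> slope_le X y v (L * b).
Proof.
move=> yd cv; have b0 := coderivative_ge0 cv.
have [_ _ h] := coderivative_approx cv.
apply: slope_le_closed; first exact: mulr_ge0.
move=> e e0; have L1 : 0 < L + 1 by rewrite ltr_wpDl.
have m0 : 0 < Num.min (Num.min e (e / (L + 1))) (d - enorm (y - x)).
  by rewrite !lt_min e0 divr_gt0// subr_gt0.
have [z [a' [w [c [rn]]]]] := h _ m0.
rewrite !lt_min => /andP[/andP[ze _] zd] _ /andP[/andP[we _] _] /andP[/andP[_ cb] _].
have zx : enorm (z - x) < d.
  by apply: le_lt_trans (enorm_sub_triangle _ _ y) _; rewrite -ltrBrDr.
exists z, w, (c * L); split=> //; last by rewrite -[c]opprK; exact: regular_normal_slope rn.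
rewrite ltr_pdivlMr// in cb.
have : L * (c - b) <= L * `|c - b| by rewrite ler_wpM2l// ler_norm.
have := normr_ge0 (c - b); lra.
Qed.

(** The approximating regular normals have a negative last component, so they occur
    at points of the graph of [f] and are multiples of regular subgradients. *)
Lemma coderivative_subdiff y a b v : enorm (y - x) < d -> 0 < b ->
  coderivative S y (const_mx a) (const_mx b) v ->
  subdiff (plus_delta f X) y (b^-1 *: v).
Proof.
move=> yd b0 /coderivative_approx[Xy fya h].
have [fy _] := f_lip Xy Xy yd yd.
apply/subdiffP; rewrite plus_deltaE//; split=> // e e0.
have [r r0 hr] := scale_approx v b0 e0; have L1 : 0 < L + 1 by rewrite ltr_wpDl.
have m0 : 0 < Num.min r (Num.min (Num.min e (e / (L + 1))) (d - enorm (y - x))).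
  by rewrite !lt_min r0 e0 divr_gt0// subr_gt0.
have [z [a' [w [c [rn]]]]] := h _ m0.
rewrite !lt_min => /andP[_ /andP[/andP[ze zL] zd]] _ /andP[wr _] /andP[cr _].
have [c0 cw] := hr c w cr wr.
have zx : enorm (z - x) < d.
  by apply: le_lt_trans (enorm_sub_triangle _ _ y) _; rewrite -ltrBrDr.
have [Ez _] := rn; have [Xz fz] := (gph_profile _ _ _ _).1 Ez.
have [fz' H] := f_lip Xz Xy zx yd.
have az : a' = fine (f z).
  apply/eqP; rewrite eq_le -[_ <= a']lee_fin (fineK fz') fz andbT leNgt.
  apply/negP => /(regular_normal_above rn fz') /eqP.
  by rewrite oppr_eq0 gt_eqF.
exists z, (c^-1 *: w); rewrite plus_deltaE//; split=> //.
  apply: le_lt_trans H _; rewrite ltr_pdivlMr// in zL.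
  by have := enorm_ge0 (z - y); lra.
rewrite az in rn; have := regular_normal_subgradient fz' _ rn.
by rewrite opprK oppr_lt0; exact.
Qed.

Lemma subdiff_coderivative y v l : 0 <= l -> subdiff (plus_delta f X) y v ->
  coderivative S y (const_mx (fine (f y))) (const_mx l) (l *: v).
Proof.
move=> l0 sv; have [Xy fy] := subdiff_fin sv; have [_ h] := (subdiffP _ _ _).1 sv.
rewrite /coderivative /= const_mxN; apply/normal_coneP; split.
  by apply/gph_profile; rewrite (fineK fy).
move=> e e0; have l1 : 0 < l + 1 by rewrite ltr_wpDl.
have m0 : 0 < Num.min (e / 2) (e / (l + 1)) by rewrite lt_min !divr_gt0.
have [z [w []]] := h _ m0; rewrite !lt_min => /andP[ze _] /andP[fze _] rw /andP[_ we].
have [Xz fz _] := (regular_subdiffP _ _ _ _).1 rw.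
rewrite !plus_deltaE// in fze.
exists (pair_row z (fine (f z))), (pair_row (l *: w) (- l)).
rewrite -!/(pair_row _ _) !pair_rowB.
split; first exact: regular_subgradient_normal.
- by apply: le_lt_trans (enorm_pair_row_le _ _) _; lra.
- apply: le_lt_trans (enorm_pair_row_le _ _) _.
  rewrite subrr normr0 addr0 -scalerBr enormZ ger0_norm//.
  rewrite ltr_pdivlMr// in we; have := enorm_ge0 (w - v); lra.
Qed.

Lemma proj_coderivativeP l v : X x -> f x \is a fin_num ->
  proj_coderivative X (profile f) x (const_mx (fine (f x))) (const_mx l) v <->
  forall e, 0 < e -> exists y a b w p,
    [/\ enorm (y - x) < e, `|a - fine (f x)| < e /\ `|b - l| < e,
        coderivative S y (const_mx a) (const_mx b) w,
        Defs.proj (tangent_cone X y) w p & enorm (p - v) < e].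
Proof.
move=> Xx fx; split.
  move=> [_ [_ [x_ [u_ [xs_ [w_ [us_ [_ [xc uc] [usc cd] hp wc]]]]]]]] e e0.
  move: xc uc usc wc => /cvg_enormP xc /cvg_enormP uc /cvg_enormP usc /cvg_enormP wc.
  have [k [[xk uk] [usk wk]]] := filter_ex (filterI (filterI (xc e e0) (uc e e0))
    (filterI (usc e e0) (wc e e0))).
  exists (x_ k), (u_ k 0 0), (us_ k 0 0), (xs_ k), (w_ k).
  rewrite -!row1_const; split=> //.
  by rewrite [u_ k]row1_const [us_ k]row1_const !const_mxB !enorm_const in uk usk.
move=> h; split=> //; split; first by rewrite /profile /= mxE fineK.
have /choose_approx[s hs] : forall e, 0 < e ->
    exists s : 'rV[R]_n * R * R * 'rV[R]_n * 'rV[R]_n,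
    [/\ enorm (s.1.1.1.1 - x) < e,
        `|s.1.1.1.2 - fine (f x)| < e /\ `|s.1.1.2 - l| < e,
        coderivative S s.1.1.1.1 (const_mx s.1.1.1.2) (const_mx s.1.1.2) s.1.2,
        Defs.proj (tangent_cone X s.1.1.1.1) s.1.2 s.2 & enorm (s.2 - v) < e].
  by move=> e /h[y [a [b [w [p ?]]]]]; exists (y, a, b, w, p).
exists (fun k => (s k).1.1.1.1), (fun k => const_mx (s k).1.1.1.2),
  (fun k => (s k).1.2), (fun k => (s k).2), (fun k => const_mx (s k).1.1.2); split.
- move=> k; have [_ _ [/gph_profile[Xs fs] _] _ _] := hs k.
  by split=> //; rewrite /profile /= mxE.
- split; apply: cvg_enorm_invS => k; first by case: (hs k).
  by rewrite const_mxB enorm_const; case: (hs k) => _ [].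
- split; last by move=> k; case: (hs k).
  by apply: cvg_enorm_invS => k; rewrite const_mxB enorm_const; case: (hs k) => _ [].
- by move=> k; case: (hs k).
- by apply: cvg_enorm_invS => k; case: (hs k).
Qed.

Context (d_gt0 : 0 < d).
Context (Xx : X x).
Context (f_fin : f x \is a fin_num).

Lemma proj_coderivative_lt0 l v : l < 0 ->
  ~ proj_coderivative X (profile f) x (const_mx (fine (f x))) (const_mx l) v.
Proof.
move=> l0 /proj_coderivativeP h; have m0 : 0 < - l by rewrite oppr_gt0.
have [y [a [b [w [p [_ [_ bl] cw _ _]]]]]] := h Xx f_fin _ m0.
have := coderivative_ge0 cw; move: bl; rewrite ltr_norml => /andP[_]; lra.
Qed.

(** The projections are bounded by [L] times the last component of the normals,
    which tends to 0 here. *)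
Lemma proj_coderivative0 :
  proj_coderivative X (profile f) x (const_mx (fine (f x))) (const_mx 0) = [set 0].
Proof.
apply/seteqP; split=> [v /proj_coderivativeP h|_ ->].
  apply: enorm0_eq0; apply/eqP; rewrite eq_le enorm_ge0 andbT.
  apply: (@le_of_approx _ _ _ (L + 1)) => e e0 _.
  have m0 : 0 < Num.min e d by rewrite lt_min e0.
  have [y [a [b [w [p []]]]]] := h Xx f_fin _ m0.
  rewrite !lt_min => /andP[_ yd] [_ /andP[be _]] cw pp /andP[pe _].
  have b0 := coderivative_ge0 cw; rewrite subr0 (ger0_norm b0) in be.
  have pL : enorm p <= L * b.
    by apply: proj_le_slope pp; [exact: mulr_ge0|exact: coderivative_slope cw].
  have := enorm_le_dist v p; rewrite enorm_subC.
  have := ler_wpM2l L_ge0 (ltW be); lra.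
apply/proj_coderivativeP => // e e0; exists x, (fine (f x)), 0, 0, 0.
rewrite !subrr enorm0 normr0; split=> //; last first.
  by apply: proj_self; rewrite -(scale0r (x - x)); exact: tangent_direction.
have Ex : epi (pair_row x (fine (f x))) by apply/gph_profile; rewrite fineK.
rewrite /coderivative /= const_mxN oppr0; apply/normal_coneP; split=> // e' e'0.
exists (pair_row x (fine (f x))), (pair_row 0 0).
rewrite -!/(pair_row _ _) !pair_rowB !subrr.
have -> : enorm (pair_row (0 : 'rV[R]_n) 0) = 0.
  apply/eqP; rewrite eq_le enorm_ge0 andbT; apply: le_trans (enorm_pair_row_le _ _) _.
  by rewrite enorm0 normr0 addr0.
split=> //; split=> // u _; have [w [b ->]] := pair_rowE u.
by rewrite dotp_pair_row dotpC dotp0r mul0r addr0.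
Qed.

Lemma proj_coderivative_gt0 l : 0 < l ->
  proj_coderivative X (profile f) x (const_mx (fine (f x))) (const_mx l) =
  [set l *: v | v in proj_subdiff X f x].
Proof.
move=> l0; apply/seteqP; split=> [v /proj_coderivativeP h|_ [v pv <-]].
  exists (l^-1 *: v); last by rewrite scalerA divff ?scale1r// gt_eqF.
  apply/proj_subdiffP; split=> //; split=> // e e0.
  have [r r0 hr] := scale_approx v l0 e0; have L1 : 0 < L + 1 by rewrite ltr_wpDl.
  have m0 : 0 < Num.min r (Num.min (Num.min e (e / (L + 1))) d).
    by rewrite !lt_min r0 e0 divr_gt0.
  have [y [a [b [w [p []]]]]] := h Xx f_fin _ m0.
  rewrite !lt_min => /andP[_ /andP[/andP[ye yL] yd]] [_ /andP[br _]] cw pp /andP[pr _].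
  have [b0 bp] := hr b p br pr; have bi : 0 < b^-1 by rewrite invr_gt0.
  have sw := coderivative_subdiff yd b0 cw; have [Xy _] := subdiff_fin sw.
  exists y, (b^-1 *: w), (b^-1 *: p); split=> //; last exact: proj_tangentZ.
  have xd : enorm (x - x) < d by rewrite subrr enorm0.
  have [_ H] := f_lip Xy Xx yd xd; apply: le_lt_trans H _.
  rewrite ltr_pdivlMr// in yL; have := enorm_ge0 (y - x); lra.
apply/proj_coderivativeP => // e e0.
have [_ [_ h]] := (proj_subdiffP _ _ _ _).1 pv.
have m0 : 0 < Num.min e (e / l) by rewrite lt_min e0 divr_gt0.
have [y [w [p []]]] := h _ m0.
rewrite !lt_min => /andP[ye _] /andP[fye _] sw pp /andP[_ pe].
exists y, (fine (f y)), l, (l *: w), (l *: p); rewrite subrr normr0; split=> //.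
- by apply: subdiff_coderivative => //; exact: ltW.
- exact: proj_tangentZ.
- by rewrite -scalerBr enormZ gtr0_norm// mulrC -ltr_pdivlMr.
Qed.

End ProfileCoderivative.

(** * The equivalent conditions and the attained modulus *)

Section Equivalences.
Context {R : realType} {n : nat} (X : set 'rV[R]_n) (f : 'rV[R]_n -> \bar R).
Context (x : 'rV[R]_n).
Context (X_convex : convex_set (X : set (convex_lmodType 'rV[R]_n))).
Context (X_closed : closed X).
Context (Xx : X x).
Context (f_fin : f x \is a fin_num).
Context (f_lsc : locally_lsc f x).

Lemma locally_lipschitz_ball : locally_lipschitz X f x ->
  exists L d, [/\ 0 <= L, 0 < d & lip_ball X f x L d].
Proof.
rewrite /locally_lipschitz => lf.
have [L L0 lL] : exists2 L, 0 <= L & (lip X f x < L%:E)%E.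
  move: lf; case: (lip X f x) => [r _| //|_]; last by exists 0 => //; exact: ltNye.
  by exists (`|r| + 1); rewrite ?addr_ge0// lte_fin ltr_pwDr// ler_norm.
by have [d d0 fL] := lip_lt_ball f_fin Xx lL; exists L, d.
Qed.

Lemma locally_bounded_proj_subdiff : locally_lipschitz X f x ->
  locally_bounded (proj_subdiff X f) x.
Proof.
move=> /locally_lipschitz_ball[L [d [L0 d0 fL]]].
exists [set y | enorm (y - x) < d]; first by apply/nbhs_enormP; exists d.
apply/bounded_enormP; exists L => w [y yd pw].
exact: proj_subdiff_le yd pw.
Qed.

Lemma proj_of_subdiff_sub y : proj_of_subdiff X f y `<=` proj_subdiff X f y.
Proof.
move=> w [Xy [v sv pw]]; have [_ fy] := subdiff_fin sv.
apply/proj_subdiffP; split=> //; split=> // e e0; exists y, v, w.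
by rewrite !subrr enorm0 normr0.
Qed.

Lemma bounded_horizon_proj_subdiff : locally_bounded (proj_of_subdiff X f) x ->
  horizon_proj_subdiff X f x = [set 0].
Proof.
move=> [U /nbhs_enormP[d d0 xU] /bounded_enormP[M hM]].
apply/seteqP; split=> [w /horizon_proj_subdiffP[_ [_ h]]|_ ->]; last first.
  exact: horizon_proj_subdiff0.
apply: enorm0_eq0; apply/eqP; rewrite eq_le enorm_ge0 andbT.
apply: (@le_of_approx _ _ _ (`|M| + 1)) => e e0 _.
have m0 : 0 < Num.min e d by rewrite lt_min e0.
have [y [v [p [l []]]]] := h _ m0.
rewrite !lt_min => -[/andP[_ yd] _] sv pp /andP[l0 /andP[le _]] /andP[we _].
have pM : enorm p <= `|M|.
  apply: le_trans (ler_norm _); apply: hM; exists y; first exact: xU.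
  by have [Xy _] := subdiff_fin sv; split=> //; exists v.
have := enorm_le_dist w (l *: p); rewrite enorm_subC enormZ gtr0_norm//.
have := ler_pM (ltW l0) (enorm_ge0 p) (ltW le) pM; lra.
Qed.

Lemma horizon_trivial_lipschitz : horizon_proj_subdiff X f x = [set 0] ->
  locally_lipschitz X f x.
Proof.
move=> H; have [d [K [d0 K0 nst]]] :=
  horizon_trivial_not_steep Xx f_fin H.
have K1 : K < K + 1 by rewrite ltrDl.
have [rho rho0 fK] := not_steep_lip_ball X_convex X_closed Xx f_fin f_lsc d0 K0 nst K1.
by apply: le_lt_trans (lip_ball_le rho0 _ fK) (ltry _); rewrite addr_ge0.
Qed.

(** A regular subgradient scaled by [l] has slope at most [l L], which vanishes in
    the limit. *)
Lemma horizon_subdiff_normal L d y : 0 <= L -> lip_ball X f x L d ->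
  enorm (y - x) < d -> X y ->
  horizon_subdiff (plus_delta f X) y `<=` normal_cone X y.
Proof.
move=> L0 fL yd Xy v hv; apply: slope_le_normal => //.
apply: slope_le_closed => // e e0; have L1 : 0 < L + 1 by rewrite ltr_wpDl.
have m0 : 0 < Num.min (Num.min e (e / (L + 1))) (d - enorm (y - x)).
  by rewrite !lt_min e0 divr_gt0// subr_gt0.
have [z [w [l []]]] := horizon_subdiff_approx hv m0.
rewrite !lt_min => /andP[l0 /andP[/andP[_ lL] _]] /andP[/andP[ze _] zd] rw.
move=> /andP[/andP[we _] _].
have zx : enorm (z - x) < d.
  by apply: le_lt_trans (enorm_sub_triangle _ _ y) _; rewrite -ltrBrDr.
exists z, (l *: w), (l * L); split=> //.
  by rewrite add0r; rewrite ltr_pdivlMr// in lL; lra.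
move=> a Xa; rewrite dotpZl -mulrA ler_pM2l//.
apply: (regular_slope_le X_convex fL zx rw); exact: Xa.
Qed.

(** Unless [x] is isolated in [X], every neighborhood of [(x, x)] contains a pair at
    which the nonnegative difference quotient is evaluated. *)
Lemma lip_ge0 : (0%:E <= lip X f x)%E.
Proof.
rewrite /lip; case: asboolP => // nis; apply: limf_esup_ge0; last first.
  by move=> p; rewrite mule_ge0// lee_fin invr_ge0 enorm_ge0.
move=> [[A B] /= [/nbhs_enormP[d1 d10 xA] /nbhs_enormP[d2 d20 xB]] AB0].
apply: nis; split; first exact: mem_set.
exists [set y | enorm (y - x) < Num.min d1 d2].
  by apply/nbhs_enormP; exists (Num.min d1 d2) => //; rewrite lt_min d10.
apply/seteqP; split=> [y [/=]|_ ->]; last first.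
  by split=> //=; rewrite subrr enorm0 lt_min d10.
rewrite lt_min => /andP[yd _] Xy; apply: contrapT => yx.
have ABy : (A `*` B) (y, x) by split; [exact: xA|apply: xB; rewrite subrr enorm0].
exact: AB0 ABy (And3 Xy Xx yx).
Qed.

Lemma proj_subdiff_le_lip v : proj_subdiff X f x v ->
  ((enorm v)%:E <= lip X f x)%E.
Proof.
move=> pv; have := lip_ge0.
case E : (lip X f x) => [r| |] // r0; last by rewrite leey.
rewrite !lee_fin in r0 *; apply/ler_addgt0Pr => e e0.
have [|d d0 fL] := @lip_lt_ball _ _ X f x (r + e) f_fin Xx.
  by rewrite E lte_fin ltrDl.
apply: proj_subdiff_le fL _ pv => //; first by rewrite addr_ge0// ltW.
by rewrite subrr enorm0.
Qed.

(** Were there no projected subgradient of norm close to the modulus, [f] would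
    be Lipschitz continuous with a smaller constant. *)
Lemma lip_attained : locally_lipschitz X f x ->
  exists2 v, proj_subdiff X f x v & lip X f x = (enorm v)%:E.
Proof.
move=> lf; have [L [d [L0 d0 fL]]] := locally_lipschitz_ball lf.
have [m m0 lm] : exists2 m, 0 <= m & lip X f x = m%:E.
  have := lip_ge0; move: lf; rewrite /locally_lipschitz.
  by case: (lip X f x) => // r _; exists r.
have st e : 0 < e -> steep X f x e (m - e).
  move=> e0; have [me|em] := ltP m e.
    have [y [v [? ? ? ? v0]]] := steep0 X_convex X_closed Xx f_fin f_lsc e0.
    by exists y, v; split=> //; apply: le_trans v0; rewrite subr_le0 ltW.
  apply: contrapT => nst.
  have me0 : 0 <= m - e by rewrite subr_ge0.
  have K1 : m - e < m - e / 2 by lra.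
  have [rho rho0 fK] :=
    not_steep_lip_ball X_convex X_closed Xx f_fin f_lsc e0 me0 nst K1.
  have := lip_ball_le rho0 _ fK; rewrite lm lee_fin => /(_ _); lra.
have [v pv mv] := steep_limit X_convex Xx f_fin fL L0 d0 st.
exists v => //; apply/eqP; rewrite eq_le proj_subdiff_le_lip// andbT.
by rewrite lm lee_fin.
Qed.

Lemma proj_subdiff_compact : locally_lipschitz X f x ->
  compact (proj_subdiff X f x).
Proof.
move=> /locally_lipschitz_ball[L [d [L0 d0 fL]]].
apply: bounded_closed_compact.
  apply/bounded_enormP; exists L => w.
  by apply: proj_subdiff_le fL _ => //; rewrite subrr enorm0.
move=> w cw; apply/proj_subdiffP; split=> //; split=> // e e0.
have e20 : 0 < e / 2 by rewrite divr_gt0.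
have [u [/proj_subdiffP[_ [_ h]] /= uw]] : proj_subdiff X f x `&`
    [set u | enorm (u - w) < e / 2] !=set0.
  by apply: cw; apply/nbhs_enormP; exists (e / 2).
have [y [v [p [yx fyx sv pp pu]]]] := h _ e20.
exists y, v, p; split=> //; [lra|lra|].
by apply: le_lt_trans (enorm_sub_triangle _ _ u) _; lra.
Qed.

End Equivalences.

Theorem theorem3p1 (R : realType) (n : nat) (f : 'rV[R]_n -> \bar R)
    (xbar : 'rV[R]_n) (X : set 'rV[R]_n)
    (f_fin : f xbar \is a fin_num) (f_lsc : locally_lsc f xbar)
    (X_dom : X `<=` dom f) (X_closed : closed X)
    (X_convex : convex_set (X : set (convex_lmodType 'rV[R]_n)))
    (X_xbar : X xbar) :
  [/\ locally_lipschitz X f xbar <-> locally_bounded (proj_of_subdiff X f) xbar,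
      locally_lipschitz X f xbar <-> locally_bounded (proj_subdiff X f) xbar &
      locally_lipschitz X f xbar <-> horizon_proj_subdiff X f xbar = [set 0]]
  /\
  (locally_lipschitz X f xbar ->
   [/\ \forall x \near xbar, X x ->
         horizon_subdiff (plus_delta f X) x `<=` normal_cone X x,
       forall lambda : R,
         proj_coderivative X (profile f) xbar
           (const_mx (fine (f xbar))) (const_mx lambda) =
         if 0 < lambda then [set lambda *: v | v in proj_subdiff X f xbar]
         else if lambda == 0 then horizon_proj_subdiff X f xbar
         else set0 &
       [/\ proj_subdiff X f xbar !=set0,
           compact (proj_subdiff X f xbar),
           exists2 v, proj_subdiff X f xbar v & lip X f xbar = (enorm v)%:E &
           forall v, proj_subdiff X f xbar v -> ((enorm v)%:E <= lip X f xbar)%E]]).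
Proof.
have ac : locally_lipschitz X f xbar -> locally_bounded (proj_subdiff X f) xbar.
  exact: locally_bounded_proj_subdiff.
have cb : locally_bounded (proj_subdiff X f) xbar ->
    locally_bounded (proj_of_subdiff X f) xbar.
  move=> [U xU bU]; exists U => //; move: bU => /bounded_enormP[M hM].
  apply/bounded_enormP; exists M => w [y Uy pw]; apply: hM; exists y => //.
  exact: proj_of_subdiff_sub.
have bd : locally_bounded (proj_of_subdiff X f) xbar ->
    horizon_proj_subdiff X f xbar = [set 0].
  exact: bounded_horizon_proj_subdiff.
have da : horizon_proj_subdiff X f xbar = [set 0] -> locally_lipschitz X f xbar.
  exact: horizon_trivial_lipschitz.
split; first by split; split; tauto.
move=> lf; have [L [d [L0 d0 fL]]] := locally_lipschitz_ball X_xbar f_fin lf.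
split.
- apply/nbhs_enormP; exists d => // y yd Xy.
  exact: (horizon_subdiff_normal X_convex L0 fL yd Xy).
- move=> l; case: ltgtP => [l0|l0|<-].
  + exact: (proj_coderivative_gt0 L0 fL).
  + by apply/seteqP; split=> // v; exact: proj_coderivative_lt0.
  + by rewrite (bd (cb (ac lf))); exact: (proj_coderivative0 X_convex L0 fL).
- have [v pv lv] := lip_attained X_convex X_closed X_xbar f_fin f_lsc lf.
  split.
  + by exists v.
  + exact: proj_subdiff_compact.
  + by exists v.
  + exact: proj_subdiff_le_lip.
Qed.
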